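(* Let $n\ge1$, $0\le\ell\le n/2$ and $\lambda=(2^\ell,1^{n-2\ell})$, with $2$-split $(\lambda^{(1)},\ldots,\lambda^{(r)})$. Then $$s^{(2)}_\lambda[X;q]=\mathbb{B}_{\lambda^{(1)}}\mathbb{B}_{\lambda^{(2)}}\cdots\mathbb{B}_{\lambda^{(r)}}(1),$$ i.e. the $2$-Schur function equals the generalized Hall–Littlewood polynomial indexed by the $2$-split of $\lambda$.
   Context: $\Lambda$: symmetric functions over $\mathbb{Q}(q)$ with the Hall inner product; $f^\perp$ is the adjoint of multiplication by $f$; $h_r,e_r$ complete homogeneous and elementary symmetric functions ($h_0=e_0=1$, zero for $r<0$). For $a\in\mathbb{Z}$: $\mathbb{S}_a=\sum_{r\ge0}(-1)^rh_{a+r}e_r^\perp$, $\mathbb{B}_a=\sum_{j\ge0}q^j\mathbb{S}_{a+j}h_j^\perp$. For a partition $\nu=(\nu_1,\ldots,\nu_\ell)$, $\mathbb{B}_\nu=\sum_{\sigma\in S_\ell}\mathrm{sgn}(\sigma)\mathbb{B}_{\nu_1+\sigma(1)-1}\cdots\mathbb{B}_{\nu_\ell+\sigma(\ell)-\ell}$. A partition is $k$-bounded if its parts are $\le k$; the hook length of $\nu\ne\emptyset$ is $\nu_1+\ell(\nu)-1$. The $k$-split $(\lambda^{(1)},\ldots,\lambda^{(r)})$ of a $k$-bounded $\lambda$ is obtained by successively taking the longest initial segment of the remaining parts whose hook length is $\le k$. $C^{(k)}_\lambda=\mathbb{B}_{\lambda^{(1)}}\cdots\mathbb{B}_{\lambda^{(r)}}(1)$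 ($C^{(k)}_\emptyset=1$); these are linearly independent over $k$-bounded $\lambda$, and $T^{(k)}_i$ is the linear operator on their span with $T^{(k)}_iC^{(k)}_\lambda=C^{(k)}_\lambda$ if $\lambda_1=i$ and $0$ otherwise. $k$-Schur functions: $s^{(k)}_\emptyset=1$, $s^{(k)}_{(a)}=s_a$ for $1\le a\le k$, and $s^{(k)}_{(m,\lambda)}=T^{(k)}_m\mathbb{B}_ms^{(k)}_\lambda$ for nonempty $k$-bounded $\lambda$ with $\lambda_1\le m\le k$. *)

(* Defs.v *)
From HB Require Import structures.
From mathcomp Require Import all_boot all_algebra perm.
From mathcomp Require Import boolp classical_sets functions cardinality fsbigop.

Set Implicit Arguments.
Unset Strict Implicit.
Unset Printing Implicit Defensive.

Import GRing.Theory.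
Local Open Scope ring_scope.

Section SymmetricFunctions.

Variable F : fieldType.

(* A formal power series in x_0, x_1, ... is given by its coefficients: f s is
   the coefficient of x_0^(s_0) x_1^(s_1) ... x_(l-1)^(s_(l-1)), where s is a
   finite exponent vector of length l.  Since a symmetric series is invariant
   under inserting zero exponents anywhere, invariance under permutations of s
   and under padding by 0 says exactly that f is well defined on monomials and
   symmetric in infinitely many variables. *)
Local Notation series := (seq nat -> F^o).

Definition symmetric_series : {pred series} := fun f =>
  `[< [/\ forall s t, perm_eq s t -> f s = f t,
          forall s, f (0%N :: s) = f s
        & exists d, forall s, f s != 0 -> (sumn s <= d)%N] >].

(* Cauchy product: the coefficient of x^s in f g is the sum of f t * g u over
   the pairs of exponent vectors t, u of the length of s with t + u = s. *)
Fixpoint smul (f g : series) (s : seq nat) {struct s} : F^o :=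
  if s is a :: s' then
    \sum_(i < a.+1)
      smul (fun t => f (nat_of_ord i :: t)) (fun u => g ((a - i)%N :: u)) s'
  else f [::] * g [::].

Definition sone : series := fun s => (sumn s == 0%N)%:R.

Lemma symmetric_series_submod : submod_closed symmetric_series.
Proof.
split.
  apply/asboolP; split=> //.
  by exists 0%N => s; rewrite eqxx.
move=> c f g /asboolP[pf zf [df bf]] /asboolP[pg zg [dg bg]].
apply/asboolP; split.
- by move=> s t st; rewrite !fctE (pf _ _ st) (pg _ _ st).
- by move=> s; rewrite !fctE zf zg.
exists (maxn df dg) => s; rewrite !fctE leq_max => nz.
have [f0|/bf->//] := eqVneq (f s) 0; have [g0|/bg->//] := eqVneq (g s) 0.
  by move: nz; rewrite f0 g0 scaler0 addr0 eqxx.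
by rewrite orbT.
Qed.

HB.instance Definition _ :=
  GRing.isSubmodClosed.Build F series symmetric_series symmetric_series_submod.

Record Lam := MkLam { coef :> series; coefP : coef \in symmetric_series }.

HB.instance Definition _ := [isSub for coef].
HB.instance Definition _ := [Choice of Lam by <:].
HB.instance Definition _ := [SubChoice_isSubLmodule of Lam by <:].

Lemma LamE (f g : Lam) : (forall s, f s = g s) -> f = g.
Proof. by move=> fg; apply/val_inj/funext. Qed.

Lemma Lam_perm (f : Lam) s t : perm_eq s t -> f s = f t.
Proof. by have /asboolP[pf _ _] := coefP f; apply: pf. Qed.

Lemma Lam_zero (f : Lam) s : f (0%N :: s) = f s.
Proof. by have /asboolP[_ zf _] := coefP f; apply: zf. Qed.

Lemma Lam_bounded (f : Lam) : exists d, forall s, f s != 0 -> (sumn s <= d)%N.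
Proof. by have /asboolP[_ _] := coefP f. Qed.

Lemma smulDl f1 f2 g s :
  smul (fun t => f1 t + f2 t) g s = smul f1 g s + smul f2 g s.
Proof.
elim: s f1 f2 g => [|a s IH] f1 f2 g /=; first by rewrite mulrDl.
by rewrite -big_split; apply: eq_bigr => i _; rewrite IH.
Qed.

Lemma smulZl c f g s : smul (fun t => c * f t) g s = c * smul f g s.
Proof.
elim: s f g => [|a s IH] f g /=; first by rewrite mulrA.
by rewrite mulr_sumr; apply: eq_bigr => i _; rewrite IH.
Qed.

Lemma smulC f g s : smul f g s = smul g f s.
Proof.
elim: s f g => [|a s IH] f g /=; first by rewrite mulrC.
rewrite (reindex_inj rev_ord_inj); apply: eq_bigr => i _ /=.
by rewrite IH subSS subKn // -ltnS.
Qed.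

Lemma smul_suml n (G : 'I_n -> series) g s :
  smul (fun t => \sum_(i < n) G i t) g s = \sum_(i < n) smul (G i) g s.
Proof.
elim: n G => [|n IH] G.
  have -> : (fun t => \sum_(i < 0) G i t) = (fun t => 0 * sone t).
    by apply/funext => t; rewrite big_ord0 mul0r.
  by rewrite smulZl mul0r big_ord0.
rewrite big_ord_recl -IH -smulDl; congr smul.
by apply/funext => t; rewrite big_ord_recl.
Qed.

Lemma smulA f g h s : smul f (smul g h) s = smul (smul f g) h s.
Proof.
elim: s f g h => [|a s IH] f g h /=; first by rewrite mulrA.
pose G i j k := smul (smul (fun t => f (i :: t)) (fun t => g (j :: t)))
                  (fun t => h (k :: t)) s.
transitivity (\sum_(0 <= i < a.+1) \sum_(0 <= j < (a - i).+1)
                G i j (a - i - j)%N).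
  rewrite big_mkord; apply: eq_bigr => i _; rewrite smulC smul_suml big_mkord.
  by apply: eq_bigr => j _; rewrite smulC IH.
transitivity (\sum_(0 <= k < a.+1) \sum_(0 <= i < k.+1)
                G i (k - i)%N (a - k)%N); last first.
  by rewrite big_mkord; apply: eq_bigr => i _; rewrite smul_suml big_mkord.
rewrite [RHS]big_nat.
under [RHS]eq_bigr => k /andP[_ ka].
  rewrite (big_nat_widen _ _ _ _ _ ka) big_mkcond.
  over.
rewrite -big_nat exchange_big_nat /=; apply: eq_big_nat => i /andP[_ ia].
rewrite [RHS](big_cat_nat (n := i)) /=; [|by []|exact: ltnW].
rewrite [X in _ = X + _]big_nat_cond [X in _ = X + _]big1 ?add0r; last first.
  by move=> k /andP[/andP[_ ki] _]; rewrite ltnS leqNgt ki.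
rewrite -[X in _ = bigop.body _ (index_iota X _) _]add0n big_addn subSn; last by rewrite -ltnS.
apply: eq_big_nat => j _.
by rewrite ltnS leq_addl addnK subnDA subnAC.
Qed.

Lemma smul1 f s : smul sone f s = f s.
Proof.
elim: s f => [|a s IH] f /=; first by rewrite /sone mul1r.
rewrite big_ord_recl big1 => [|i _] /=; first by rewrite addr0 IH subn0.
rewrite (_ : (fun t => sone _) = (fun t => 0 * sone t)); last first.
  by apply/funext => t; rewrite mul0r.
by rewrite smulZl mul0r.
Qed.

Lemma smul_swap (f g : series) :
  (forall s t, perm_eq s t -> f s = f t) ->
  (forall s t, perm_eq s t -> g s = g t) ->
  forall a b s, smul f g [:: a, b & s] = smul f g [:: b, a & s].
Proof.
move=> pf pg a b s /=; rewrite exchange_big; apply: eq_bigr => i _ /=.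
apply: eq_bigr => j _; congr smul; apply/funext => t; [apply: pf|apply: pg].
  by rewrite (perm_catCA [:: _] [:: _]).
by rewrite (perm_catCA [:: _] [:: _]).
Qed.

Lemma smul_perm (f g : series) :
  (forall s t, perm_eq s t -> f s = f t) ->
  (forall s t, perm_eq s t -> g s = g t) ->
  forall s t, perm_eq s t -> smul f g s = smul f g t.
Proof.
have tl (k : series) a : (forall s t, perm_eq s t -> k s = k t) ->
    forall s t, perm_eq s t -> k (a :: s) = k (a :: t).
  by move=> pk s t st; apply: pk; rewrite perm_cons.
have front : forall t1 (f g : series),
  (forall s t, perm_eq s t -> f s = f t) ->
  (forall s t, perm_eq s t -> g s = g t) ->
  forall a t2, smul f g (t1 ++ a :: t2) = smul f g (a :: t1 ++ t2).
  elim=> [//|b t1 IH] {}f {}g pf pg a t2.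
  rewrite cat_cons [RHS]smul_swap // [LHS]/=; apply: eq_bigr => i _.
  by apply: IH; apply: tl.
move=> pf pg s; elim: s f g pf pg => [|a s IH] f g pf pg t.
  by move/perm_size/esym/size0nil->.
move=> st; have : a \in t by rewrite -(perm_mem st) mem_head.
move=> a_t; case/splitPr: t / a_t st => t1 t2 st; rewrite front //=.
apply: eq_bigr => i _; apply: IH; try exact: tl.
by rewrite -(perm_cons a) (perm_trans st) // (perm_catCA t1 [:: a]).
Qed.

Lemma smul_eq0 (f g : series) s :
  (forall t u, (sumn t + sumn u)%N = sumn s -> f t * g u = 0) ->
  smul f g s = 0.
Proof.
elim: s f g => [|a s IH] f g fg /=; first exact: fg.
apply: big1 => i _; apply: IH => t u tu; apply: fg => /=.
by rewrite addnACA tu subnKC // -ltnS.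
Qed.

Lemma symmetric_smul (f g : Lam) : smul f g \in symmetric_series.
Proof.
have [df bf] := Lam_bounded f; have [dg bg] := Lam_bounded g.
apply/asboolP; split.
- by apply: smul_perm => s t; apply: Lam_perm.
- move=> s /=; rewrite big_ord1 /=.
  by congr smul; apply/funext => t; rewrite Lam_zero.
exists (df + dg)%N => s; apply: contraR; rewrite -ltnNge => ds.
apply/eqP/smul_eq0 => t u tu; apply/eqP; rewrite mulf_eq0.
apply: contraLR ds; rewrite negb_or -leqNgt -tu => /andP[ft gu].
by apply: leq_add; [apply: bf|apply: bg].
Qed.

(* h_r, e_r and m_mu, through their coefficients. *)
Definition h_series (r : nat) : series := fun s => (sumn s == r)%:R.
Definition e_series (r : nat) : series :=
  fun s => ((sumn s == r) && all (fun a => a <= 1)%N s)%:R.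
Definition m_series (mu : seq nat) : series :=
  fun s => (perm_eq [seq a <- s | a != 0%N] [seq a <- mu | a != 0%N])%:R.

Lemma perm_sumn s t : perm_eq s t -> sumn s = sumn t.
Proof. by move=> st; rewrite !sumnE; apply: perm_big. Qed.

Lemma symmetric_h r : h_series r \in symmetric_series.
Proof.
apply/asboolP; split=> [s t st|s|]; rewrite /h_series ?(perm_sumn st) //.
by exists r => s; case: (sumn s =P r) => [->//|_]; rewrite eqxx.
Qed.

Lemma symmetric_e r : e_series r \in symmetric_series.
Proof.
apply/asboolP; split=> [s t st|s|]; rewrite /e_series.
- by rewrite (perm_sumn st) (perm_all _ st).
- by [].
by exists r => s; case: (sumn s =P r) => [->//|_]; rewrite eqxx.
Qed.

Lemma symmetric_m mu : m_series mu \in symmetric_series.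
Proof.
have sumn_nz s : sumn [seq a <- s | a != 0%N] = sumn s.
  by elim: s => //= -[|a] s /= ->.
apply/asboolP; split=> [s t st|s|]; rewrite /m_series.
- by rewrite (permPl (perm_filter _ st)).
- by [].
exists (sumn mu) => s; case: (boolP (perm_eq _ _)) => [st|_]; last first.
  by rewrite eqxx.
by rewrite -(sumn_nz s) (perm_sumn st) sumn_nz.
Qed.

Definition Lam_mul (f g : Lam) : Lam := MkLam (symmetric_smul f g).
Definition Lam_one : Lam := MkLam (symmetric_h 0).

Lemma Lam_mulA : associative Lam_mul.
Proof. by move=> f g k; apply: LamE => s; apply: smulA. Qed.

Lemma Lam_mulC : commutative Lam_mul.
Proof. by move=> f g; apply: LamE => s; apply: smulC. Qed.

Lemma Lam_mul1 : left_id Lam_one Lam_mul.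
Proof. by move=> f; apply: LamE => s; apply: smul1. Qed.

Lemma Lam_mulDl : left_distributive Lam_mul +%R.
Proof. by move=> f g k; apply: LamE => s; apply: smulDl. Qed.

Lemma Lam_one_neq0 : Lam_one != 0.
Proof.
apply/eqP => /(congr1 (fun f : Lam => f [::])) /eqP.
by rewrite /= oner_eq0.
Qed.

HB.instance Definition _ := GRing.Zmodule_isComNzRing.Build Lam
  Lam_mulA Lam_mulC Lam_mul1 Lam_mulDl Lam_one_neq0.

Lemma Lam_scalerAl (c : F) (f g : Lam) : c *: (f * g) = (c *: f) * g.
Proof. by apply: LamE => s; apply/esym/smulZl. Qed.

HB.instance Definition _ := GRing.Lmodule_isLalgebra.Build F Lam Lam_scalerAl.
HB.instance Definition _ := GRing.Lalgebra_isComAlgebra.Build F Lam.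

Definition h (r : int) : Lam := if r is Posz n then MkLam (symmetric_h n) else 0.
Definition e (r : int) : Lam := if r is Posz n then MkLam (symmetric_e n) else 0.

Definition is_partition (s : seq nat) : bool :=
  path.sorted geq s && (0%N \notin s).

Definition h_part (la : seq nat) : Lam := \prod_(r <- la) h (Posz r).
Definition m_part (mu : seq nat) : Lam := MkLam (symmetric_m mu).

(* The Jacobi-Trudi determinant det (h_(la_i - i + j)). *)
Definition schur (la : seq nat) : Lam :=
  \det (\matrix_(i < size la, j < size la)
          h (Posz (nth 0%N la i) - Posz i + Posz j)).

(* The Hall inner product is the bilinear form for which the h_la and the m_mu
   are dual bases. *)
Definition is_hall (b : Lam -> Lam -> F) : Prop :=
  [/\ forall f, scalar (b f),
      forall g, scalar (fun f => b f g)
    & forall la mu, is_partition la -> is_partition mu ->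
        b (h_part la) (m_part mu) = (la == mu)%:R].

Definition hall : Lam -> Lam -> F := xget (fun _ _ => 0) is_hall.

Definition is_adjoint (A A' : Lam -> Lam) : Prop :=
  forall u v, hall (A u) v = hall u (A' v).

Definition perp (f : Lam) : Lam -> Lam :=
  xget (fun _ => 0) (is_adjoint (fun u => f * u)).

(* The infinite sums below are applied to a fixed f, where only finitely many
   terms are nonzero. *)
Definition opS (a : int) (f : Lam) : Lam :=
  \sum_(r \in [set: nat]) (-1) ^+ r *: (h (a + Posz r) * perp (e (Posz r)) f).

Variable q : F.

Definition opB (a : int) (f : Lam) : Lam :=
  \sum_(j \in [set: nat]) q ^+ j *: opS (a + Posz j) (perp (h (Posz j)) f).

(* Indices i start at 0; the shift by 1 cancels in nu_i + s(i) - i. *)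
Definition opBB (nu : seq nat) (f : Lam) : Lam :=
  \sum_(s : 'S_(size nu)) (-1) ^+ s *:
    foldr (fun (i : 'I_(size nu)) g =>
             opB (Posz (nth 0%N nu i) + Posz (s i) - Posz i) g)
          f (enum 'I_(size nu)).

Definition kbounded (k : nat) (la : seq nat) : bool :=
  is_partition la && all (fun a => a <= k)%N la.

(* Meaningful for nu nonempty; equal to 0 on the empty sequence. *)
Definition hook (nu : seq nat) : nat := (head 0 nu + size nu - 1)%N.

Definition segment_length (k : nat) (la : seq nat) : nat :=
  (\max_(j < (size la).+1 | hook (take j la) <= k) j)%N.

(* On a nonempty k-bounded partition every segment is nonempty, so the fuel n
   is sufficient as soon as size la <= n. *)
Fixpoint ksplit_rec (k n : nat) (la : seq nat) : seq (seq nat) :=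
  if n is n'.+1 then
    if la is [::] then [::] else
    let j := segment_length k la in
    take j la :: ksplit_rec k n' (drop j la)
  else [::].

Definition ksplit (k : nat) (la : seq nat) : seq (seq nat) :=
  ksplit_rec k (size la) la.

Definition Ck (k : nat) (la : seq nat) : Lam := foldr opBB 1 (ksplit k la).

(* The graph of the linear operator on the span of the Ck k la that sends
   Ck k la to itself if la_1 = i, and to 0 otherwise. *)
Definition is_T (k i : nat) (f g : Lam) : Prop :=
  exists (L : seq (seq nat)) (c : seq nat -> F),
    [/\ all (kbounded k) L,
        f = \sum_(la <- L) c la *: Ck k la
      & g = \sum_(la <- L | head 0%N la == i) c la *: Ck k la].

(* Single-valued because the Ck k la are linearly independent; set to 0 outside
   their span. *)
Definition opT (k i : nat) (f : Lam) : Lam := xget 0 (is_T k i f).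

Fixpoint kschur (k : nat) (la : seq nat) : Lam :=
  if la is m :: mu then
    if mu is [::] then schur [:: m] else opT k m (opB (Posz m) (kschur k mu))
  else 1.

End SymmetricFunctions.

(* The base field Q(q) and its indeterminate q. *)
Definition Qq : fieldType := {fraction {poly rat}}.
Definition qq : Qq := tofrac ('X : {poly rat}).

(* Main.v *)
(* Write H_j and E_r for the adjoints of multiplication by h_j and e_r; on
   coefficients, H_j f (s) = f (j :: s).  The Hall form exists because the h_la
   span and the coefficient of x^mu in h_la is symmetric in la and mu, so that
   sum_i c_i h_(la_i), g |-> sum_i c_i g(la_i) is well defined; consequently
   every multiplication operator has an adjoint.

   B_a = sum_k h_(a+k) P_k, where P_k = sum_(r+j=k) (-1)^r q^j E_r H_j, and the
   rules for H_j and E_r on h_n f give Jing's relation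
     B_m B_n - q B_(m+1) B_(n-1) = q B_n B_m - B_(n-1) B_(m+1).
   Hence B_(1,1) = B_1 B_1 - B_2 B_0 commutes with B_1, and
   B_1 B_(1,1)^p B_1 (1) differs from B_(1,1)^(p+1) (1) by
   B_(1,1)^p B_2 (1), which lies in B_2 applied to the span of the
   B_2^a B_(1,1)^b (1).  So B_1 C_(1^n) is C_(1^(n+1)) plus a combination of
   C_la with la_1 = 2, which T_1 kills; for la_1 = 2 the operator T_2 does
   nothing.  T_1 and T_2 are single-valued because the coefficients of the
   powers of h_1 in the h-basis vanish on the image of B_2 and separate the
   C_(1^n). *)

From HB Require Import structures.
Require Import Defs.
From mathcomp Require Import all_boot all_algebra.
From mathcomp Require Import fingroup perm boolp classical_sets fsbigop.
From mathcomp Require Import zify ring.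

Set Implicit Arguments.
Unset Strict Implicit.
Unset Printing Implicit Defensive.

Import GRing.Theory.
Local Open Scope ring_scope.

Arguments h : simpl never.
Arguments e : simpl never.

Lemma sum_telescope (V : zmodType) (A B : nat -> V) (N : nat) :
  A N = 0 -> B 0%N = 0 -> (forall r, B r.+1 = - A r) ->
  \sum_(r < N.+1) (A r + B r) = 0.
Proof.
move=> AN B0 BS; rewrite big_split /= big_ord_recr [X in _ + X]big_ord_recl /=.
rewrite AN B0 addr0 add0r -big_split big1 // => r _.
by rewrite /= BS subrr.
Qed.

(** * Products and coefficients *)

Section Coefficients.

Variable F : fieldType.
Local Notation Lam := (Lam F).
Local Notation h := (@h F).
Local Notation e := (@e F).
Implicit Types (f g u v : Lam) (s t : seq nat).

Lemma coefD f g s : (f + g) s = f s + g s.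
Proof. by []. Qed.

Lemma coefB f g s : (f - g) s = f s - g s.
Proof. by []. Qed.

Lemma coefZ (c : F) f s : (c *: f) s = c * f s.
Proof. by []. Qed.

Lemma coef0 s : (0 : Lam) s = 0.
Proof. by []. Qed.

Lemma coef1 s : (1 : Lam) s = (sumn s == 0%N)%:R.
Proof. by []. Qed.

Lemma coefM f g s : (f * g) s = smul f g s.
Proof. by []. Qed.

Lemma coef_sum (I : Type) (r : seq I) (P : pred I) (G : I -> Lam) s :
  (\sum_(i <- r | P i) G i) s = \sum_(i <- r | P i) G i s.
Proof. by elim/big_rec2: _ => // i y f _ <-. Qed.

Lemma symmetric_cons f (j : nat) : (fun s => f (j :: s)) \in @symmetric_series F.
Proof.
have [d df] := Lam_bounded f.
apply/asboolP; split.
- by move=> s t st; apply: Lam_perm; rewrite perm_cons.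
- move=> s; rewrite -[RHS]Lam_zero; apply: Lam_perm.
  by rewrite (perm_catCA [:: _] [:: _]).
by exists d => s /df /(leq_trans _); apply; rewrite /= leq_addl.
Qed.

(** Indexed by all integers, with value 0 at the negative ones, so that the recursions below need no
    boundary cases. [perp_h] identifies it with the adjoint of h_j. *)
Definition cperp (j : int) f : Lam :=
  if j is Posz n then MkLam (symmetric_cons f n) else 0.
Arguments cperp : simpl never.

Lemma cperp_neg j f : j < 0 -> cperp j f = 0.
Proof. by case: j. Qed.

Lemma cperpE (j : nat) f s : cperp j f s = f (j :: s).
Proof. by []. Qed.

Lemma cperp_is_linear j : linear (cperp j).
Proof.
by case: j => j c f g; rewrite /cperp; [apply: LamE | rewrite scaler0 addr0].
Qed.
HB.instance Definition _ j := GRing.isLinear.Build F Lam Lam *:%R (cperp j)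
  (cperp_is_linear j).

Lemma cperpZ j c f : cperp j (c *: f) = c *: cperp j f.
Proof. exact: linearZ. Qed.

Lemma cperp_sum j (I : Type) (r : seq I) (P : pred I) (G : I -> Lam) :
  cperp j (\sum_(i <- r | P i) G i) = \sum_(i <- r | P i) cperp j (G i).
Proof. exact: raddf_sum. Qed.

Lemma cperp0 f : cperp 0 f = f.
Proof. by apply: LamE => s; rewrite cperpE Lam_zero. Qed.

Lemma cperpM (j : nat) f g :
  cperp j (f * g) = \sum_(i < j.+1) cperp i f * cperp (j - i)%N g.
Proof. by apply: LamE => s; rewrite coef_sum. Qed.

Lemma h0 : h 0 = 1.
Proof. by []. Qed.

Lemma h_neg (n : int) : n < 0 -> h n = 0.
Proof. by case: n. Qed.

Lemma e_neg (n : int) : n < 0 -> e n = 0.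
Proof. by case: n. Qed.

Lemma e0 : e 0 = 1.
Proof.
apply: LamE => s; rewrite coef1 /= /e_series; case: eqP => //= s0.
suff -> : all (fun a => a <= 1)%N s by [].
by elim: s s0 => //= a s IH; case: a.
Qed.

Lemma cperp_h (j : nat) n : cperp j (h n) = h (n - j%:Z).
Proof.
case: n => n; last by rewrite raddf0 h_neg //; lia.
apply: LamE => s /=; rewrite /h_series /=.
case: (leqP j n) => jn.
  rewrite subzn //= /h_series; congr (_%:R); lia.
rewrite h_neg ?coef0; last lia.
by case: eqP => //; lia.
Qed.

Lemma cperp_e1 n : cperp 1 (e n) = e (n - 1).
Proof.
case: n => n; last by rewrite raddf0 e_neg //; lia.
apply: LamE => s /=; rewrite /e_series /=.
case: n => [|n] //=.
by rewrite subn1.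
Qed.

Lemma cperp_e2 (j : nat) n : cperp j.+2 (e n) = 0.
Proof.
case: n => n; last by rewrite raddf0.
by apply: LamE => s /=; rewrite /e_series /= andbF.
Qed.

(** Peel off the term i = 0 of [cperpM]: lowering h_n by i + 1 is lowering h_(n-1) by i, so the
    remaining terms form a product rule again. *)
Lemma cperp_hM (j n : int) f :
  cperp j (h n * f) = h n * cperp j f + cperp (j - 1) (h (n - 1) * f).
Proof.
case: j => [[|j]|j]; last by rewrite !cperp_neg ?mulr0 ?addr0 //; lia.
  by rewrite !cperp0 cperp_neg ?addr0.
have -> : j.+1%:Z - 1 = j by lia.
rewrite !cperpM big_ord_recl cperp0 subn0; congr (_ + _).
apply: eq_bigr => i _; rewrite !cperp_h subSS; congr (h _ * _).
rewrite lift0; lia.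
Qed.

(** e_n has degree at most one in each variable, so only two terms of [cperpM] survive. *)
Lemma cperp_eM (j n : int) f :
  cperp j (e n * f) = e n * cperp j f + e (n - 1) * cperp (j - 1) f.
Proof.
case: j => [[|j]|j]; last by rewrite !cperp_neg ?mulr0 ?addr0 //; lia.
  by rewrite !cperp0 cperp_neg ?mulr0 ?addr0.
have -> : j.+1%:Z - 1 = j by lia.
rewrite !cperpM !big_ord_recl cperp0 subn0 lift0 cperp_e1 subSS subn0.
rewrite big1 ?addr0 // => i _; rewrite !lift0 cperp_e2 mul0r //.
Qed.

(** Coefficients are compared by induction on the exponent vector: a leading zero drops out, and a
    leading positive exponent makes the sum telescope. *)
Lemma sum_eh (k : nat) :
  \sum_(r < k.+1) (-1) ^+ r *: (e (Posz r) * h (k%:Z - r%:Z)) = (k == 0%N)%:R.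
Proof.
case: k => [|k]; first by rewrite big_ord1 expr0 scale1r e0 h0 mulr1.
apply: LamE; elim=> [|[|i] s IH]; last 1 first.
- rewrite coef0 -cperpE cperp_sum.
  pose A (r : nat) : Lam := (-1) ^+ r *: (e r * h (k%:Z - r%:Z - i%:Z)).
  pose B (r : nat) : Lam := (-1) ^+ r *: (e (r%:Z - 1) * h (k%:Z + 1 - r%:Z - i%:Z)).
  rewrite (eq_bigr (fun r : 'I_k.+2 => A r + B r)) => [|r _].
    rewrite sum_telescope //.
    - by rewrite /A (h_neg (n := _ - _)) ?mulr0 ?scaler0 //=; lia.
    - by rewrite /B e_neg ?mul0r ?scaler0.
    move=> r; rewrite /A /B exprS mulN1r scaleNr.
    congr (- (_ *: (e _ * h _))); lia.
  rewrite cperpZ cperp_eM (_ : i.+1%:Z - 1 = i) ?cperp_h ?scalerDr; last lia.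
  congr (_ *: (e _ * h _) + _ *: (e _ * h _)); lia.
- rewrite coef_sum big1 // => r _; rewrite coefZ coefM [smul _ _ _]/=.
  case: r => [[|r] rk]; first by rewrite subr0 /h /= /h_series !mulr0.
  by rewrite /e /= /e_series /= mul0r mulr0.
- by rewrite Lam_zero IH.
Qed.

End Coefficients.

(** * The complete homogeneous functions span *)

Section Spanning.

Variable F : fieldType.
Local Notation Lam := (Lam F).
Local Notation h := (@h F).
Local Notation e := (@e F).
Implicit Types (f g u v : Lam) (s t : seq nat).

Definition nonzeros s := [seq a <- s | a != 0%N].

Lemma coef_nonzeros f s : f (nonzeros s) = f s.
Proof.
elim: s f => //= -[|a] s IH f /=; first by rewrite IH Lam_zero.
by rewrite -!cperpE -/(nonzeros s) IH.
Qed.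

Lemma sumn_nonzeros s : sumn (nonzeros s) = sumn s.
Proof. by elim: s => //= -[|a] s /= ->. Qed.

Lemma size_nonzeros s : (size (nonzeros s) <= sumn s)%N.
Proof. by elim: s => //= -[|a] s /=; lia. Qed.

Lemma nonzeros_id s : 0%N \notin s -> nonzeros s = s.
Proof.
by move=> s0; apply/all_filterP/allP => x xs; apply: contraNneq s0 => <-.
Qed.

Lemma nonzeros_notin s : 0%N \notin nonzeros s.
Proof. by rewrite mem_filter. Qed.

Lemma smul_local (f f' g g' : seq nat -> F^o) s :
    (forall t, size t = size s -> f t = f' t) ->
    (forall t, size t = size s -> g t = g' t) ->
  smul f g s = smul f' g' s.
Proof.
elim: s f f' g g' => [|a s IH] f f' g g' ff gg /=; first by rewrite ff ?gg.
by apply: eq_bigr => i _; apply: IH => t st; rewrite ?ff ?gg //= st.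
Qed.

Lemma smul0l (f g : seq nat -> F^o) s :
  (forall t, size t = size s -> f t = 0) -> smul f g s = 0.
Proof.
move=> f0; rewrite (smul_local (f' := fun t => 0 * f t) (g' := g)) //.
  by rewrite smulZl mul0r.
by move=> t /f0 ->; rewrite mul0r.
Qed.

(** * Multiplication by e_l and removal of a column *)

Lemma e_series_short l t : (size t < l)%N -> e_series F l t = 0.
Proof.
move=> tl; rewrite /e_series; case: eqP => //= tE; case: allP => // t1.
suff : (sumn t <= size t)%N by lia.
by elim: t t1 {tl tE} => //= a t IH t1; rewrite -add1n leq_add ?t1 ?mem_head //
  IH // => x xt; rewrite t1 // inE xt orbT.
Qed.

(** Among vectors of the length of [s], the series of e_(size s) sees only (1,...,1), so the
    convolution has a single term. *)
Lemma smul_e_exact (g : seq nat -> F^o) s :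
  0%N \notin s -> smul (e_series F (size s)) g s = g (map predn s).
Proof.
elim: s g => [|[|a] s IH] g //=; first by rewrite /e_series mul1r.
rewrite inE /= => s0; rewrite !big_ord_recl [X in _ + (_ + X)]big1 => [|i _].
  rewrite addr0 smul0l ?add0r => [|t st].
    rewrite /= subSS subn0 -(IH (fun t => g (a :: t)) s0).
    by apply: smul_local => t st //; rewrite /e_series /= add1n eqSS.
  by apply: (e_series_short (l := (size s).+1) (t := t)); rewrite st.
by apply: smul0l => t st; rewrite /e_series /= andbF.
Qed.

(* The exponents of [s], padded by zeros to length [l] and then increased by 1,
   when [s] has at most [l] nonzero exponents. *)
Definition add_column l s := map S (nonzeros s ++ nseq (l - size (nonzeros s)) 0%N).

Lemma symmetric_remove_column l f :
  (fun s => if (size (nonzeros s) <= l)%N then f (add_column l s) else 0 : F^o)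
    \in @symmetric_series F.
Proof.
have [d df] := Lam_bounded f; apply/asboolP; split=> [s t st|//|].
  have nst : perm_eq (nonzeros s) (nonzeros t) by apply: perm_filter.
  rewrite (perm_size nst); case: ifP => // _; apply: Lam_perm.
  by apply: perm_map; rewrite (perm_size nst) perm_cat2r.
exists d => s; case: ifP => [_ /df|]; last by rewrite eqxx.
apply: leq_trans; rewrite /add_column map_cat sumn_cat.
apply: (leq_trans _ (leq_addr _ _)); rewrite -(sumn_nonzeros s).
by elim: (nonzeros s) => //= a t; lia.
Qed.

Definition remove_column l f : Lam := MkLam (symmetric_remove_column l f).

Lemma sumn_add_column l s :
  (size (nonzeros s) <= l)%N -> sumn (add_column l s) = (sumn s + l)%N.
Proof.
move=> sl; rewrite -(sumn_nonzeros s) /add_column.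
have E t : sumn (map S t) = (sumn t + size t)%N by elim: t => //= a t ->; lia.
by rewrite E size_cat size_nseq sumn_cat sumn_nseq mul0n addn0 subnKC.
Qed.

(** A strict degree bound: [small f 0] means f = 0, and lowering operators act on the bound by
    truncated subtraction. *)
Definition small f d := forall s, (d <= sumn s)%N -> f s = 0.

Lemma smallP f : exists d, small f d.
Proof.
have [d df] := Lam_bounded f; exists d.+1 => s ds.
by apply: contraTeq ds => /df; lia.
Qed.

Lemma small_leq d d' f : (d <= d')%N -> small f d -> small f d'.
Proof. by move=> dd sf s /(leq_trans dd); apply: sf. Qed.

Lemma smallD d f g : small f d -> small g d -> small (f + g) d.
Proof. by move=> sf sg s ds; rewrite coefD sf ?sg ?addr0. Qed.

Lemma smallZ d c f : small f d -> small (c *: f) d.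
Proof. by move=> sf s ds; rewrite coefZ sf ?mulr0. Qed.

Lemma small_e r : small (e (Posz r)) r.+1.
Proof. by move=> s ds; rewrite /e /= /e_series; case: eqP => //; lia. Qed.

Lemma small_remove_column l f d : small f d -> small (remove_column l f) (d - l).
Proof.
move=> sf s ds /=; case: ifP => // sl; apply: sf.
by rewrite sumn_add_column //; lia.
Qed.

Lemma smallM f g d d' : small f d.+1 -> small g d' -> small (f * g) (d + d').
Proof.
move=> sf sg s ds; rewrite coefM; apply: smul_eq0 => t u tu.
have [/sf->|ltd] := leqP d.+1 (sumn t); first by rewrite mul0r.
by rewrite sg ?mulr0 //; lia.
Qed.

Lemma perm_nonzeros_pad s :
  perm_eq (nonzeros s ++ nseq (size s - size (nonzeros s)) 0%N) s.
Proof.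
elim: s => //= -[|a] s IH /=; last by rewrite perm_cons subSS.
rewrite subSn ?size_filter ?count_size //= -size_filter.
by rewrite -cat1s perm_catCA perm_cons.
Qed.

Lemma remove_column_exact l f s : size (nonzeros s) = l ->
  (e (Posz l) * remove_column l f) s = f s.
Proof.
move=> sl; rewrite -coef_nonzeros -[RHS]coef_nonzeros coefM.
have := nonzeros_notin s; move: (nonzeros s) sl => t <- n0.
rewrite smul_e_exact // [LHS]/=.
have -> : (size (nonzeros (map predn t)) <= size t)%N.
  by rewrite -(size_map predn t) size_filter count_size.
apply: Lam_perm; apply: (perm_trans (y := map S (map predn t))).
  apply: perm_map; have := perm_nonzeros_pad (map predn t).
  by rewrite size_map.
rewrite -map_comp map_id_in // => -[|a] //; by rewrite (negPf n0).
Qed.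

Lemma e_mul_short l f s : (size (nonzeros s) < l)%N -> (e (Posz l) * f) s = 0.
Proof.
move=> sl; rewrite -coef_nonzeros coefM smul0l // => t st.
by rewrite /e /= e_series_short ?st.
Qed.

(* Downward induction on the length of exponent vectors: e_l * remove_column l f
   agrees with f on the vectors with l nonzero entries, vanishes on those with
   fewer, and remove_column l f has smaller degree; e_l is a polynomial in the h_r. *)
Lemma Lam_ind (P : Lam -> Prop) :
    P 1 -> (forall f g, P f -> P g -> P (f + g)) ->
    (forall c f, P f -> P (c *: f)) ->
    (forall (r : nat) f, P f -> P (h r * f)) ->
  forall f, P f.
Proof.
move=> P1 PD PZ Ph.
have P0 : P 0 by rewrite -(scale0r 1); apply: PZ.
have Psum (I : Type) (r : seq I) (p : pred I) (G : I -> Lam) :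
  (forall i, p i -> P (G i)) -> P (\sum_(i <- r | p i) G i).
  by move=> PG; apply: big_ind.
(* [sum_eh] expresses e_(r+1) through the products e_i h_(r+1-i) with i <= r. *)
have Pe r : forall f, P f -> P (e (Posz r) * f).
  elim/ltn_ind: r => -[|r] IH f Pf; first by rewrite e0 mul1r.
  have /eqP := sum_eh F r.+1; rewrite big_ord_recr /= subrr mulr1 addrC.
  rewrite addr_eq0 => /eqP /(congr1 (fun g => (-1) ^+ r.+1 *: g)).
  rewrite scalerA -expr2 sqrr_sign scale1r => ->.
  rewrite scalerN mulNr -scaleN1r -scalerAl mulr_suml; apply/PZ/PZ/Psum => i _.
  rewrite -scalerAl -mulrA subzn; last exact/ltnW.
  by apply/PZ/IH/Ph.
(* Outer induction on the degree bound [d], inner on [m], which bounds d - l; exponent vectors in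
   the support of [f] have at least [l] nonzero entries. *)
suff main d : forall m l f, (d - l <= m)%N -> small f d ->
    (forall s, (size (nonzeros s) < l)%N -> f s = 0) -> P f.
  by move=> f; have [d sf] := smallP f; apply: (main d d 0%N); rewrite ?subn0.
elim/ltn_ind: d => d IHd; elim=> [|m IHm] l f dl sf lf.
  suff -> : f = 0 by [].
  apply: LamE => s; have [/sf//|sd] := leqP d (sumn s).
  by rewrite lf // (leq_ltn_trans (size_nonzeros s)) //; lia.
have [dl0|dl0] := leqP d l.
  rewrite (_ : f = 0) //.
  apply: LamE => s; have [/sf//|sd] := leqP d (sumn s).
  by rewrite lf // (leq_ltn_trans (size_nonzeros s)) //; lia.
have [l0|l_gt0] := posnP l.
  pose c : F := f [::].
  have -> : f = c *: 1 + (f - c *: 1) by rewrite addrC subrK.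
  apply: PD; first exact: PZ.
  apply: (IHm 1%N); first lia.
    move=> s ds; rewrite coefB coefZ coef1 sf //.
    by rewrite (_ : (_ == _) = false) ?mulr0 ?subr0 //; apply/eqP; lia.
  move=> s; rewrite ltnS leqn0 size_eq0 coefB coefZ coef1 => /eqP s0.
  by rewrite -sumn_nonzeros -coef_nonzeros s0 mulr1 subrr.
have -> : f = e (Posz l) * remove_column l f + (f - e (Posz l) * remove_column l f).
  by rewrite addrC subrK.
have sr := small_remove_column (l := l) sf.
(* Since l > 0, [remove_column] lowers the degree bound, and the outer induction restarts from l =
   0. *)
apply: PD; first by apply: Pe; apply: (IHd (d - l)%N _ _ 0%N _ (leqnn _)) => //; lia.
apply: (IHm l.+1); first lia.
  move=> s ds; rewrite coefB sf // (smallM (small_e (r := l)) sr) ?subrr //; lia.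
move=> s; rewrite ltnS leq_eqVlt coefB => /orP[/eqP sl|sl].
  by rewrite remove_column_exact // subrr.
by rewrite lf // e_mul_short // subrr.
Qed.

End Spanning.

(** * The Hall form and adjoints *)

Section Hall.

Variable F : fieldType.
Local Notation Lam := (Lam F).
Local Notation h := (@h F).
Local Notation e := (@e F).
Implicit Types (f g u v : Lam) (s t : seq nat).

Lemma h_part_nil : h_part F [::] = 1.
Proof. exact: big_nil. Qed.

Lemma h_part_cons a s : h_part F (a :: s) = h (Posz a) * h_part F s.
Proof. exact: big_cons. Qed.

Lemma sum_ord_support (V : nmodType) (G : nat -> V) m n :
    (forall i, (m <= i)%N -> G i = 0) -> (forall i, (n <= i)%N -> G i = 0) ->
  \sum_(i < m) G i = \sum_(i < n) G i.
Proof.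
move=> Gm Gn; wlog mn : m n Gm Gn / (m <= n)%N => [W|].
  by case: (leqP m n) => [/W|/ltnW /W] ->.
rewrite (big_ord_widen _ _ mn) big_mkcond; apply: eq_bigr => i _.
by case: ltnP => // /Gm.
Qed.

(* The factor u carries the parts of la already split off in the induction. *)
Lemma smul_h_part (m : nat) u mu la :
  smul (h m) (fun t => (u * h_part F t) mu) la = (u * cperp m (h_part F la)) mu.
Proof.
elim: la m u => [|a la IH] m u.
  rewrite [LHS](_ : _ = h m [::] * (u * h_part F [::]) mu) // h_part_nil mulr1.
  rewrite -h0 cperp_h; case: m => [|m]; first by rewrite h0 mulr1 mul1r.
  by rewrite (@h_neg F (0 - _)) // mulr0 [h _ _](_ : _ = 0) ?mul0r.
pose G (i : nat) : F :=
  (u * (h (a%:Z - i%:Z) * cperp (m%:Z - i%:Z) (h_part F la))) mu.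
have Ga i : (a.+1 <= i)%N -> G i = 0.
  by move=> ai; rewrite /G h_neg ?mul0r ?mulr0 //; lia.
have Gm i : (m.+1 <= i)%N -> G i = 0.
  by move=> ai; rewrite /G cperp_neg ?mul0r ?mulr0 //; lia.
transitivity (\sum_(i < a.+1) G i).
  apply: eq_bigr => i _; have [im|mi] := leqP i m; last first.
    rewrite Gm //; apply: smul0l => t _; rewrite /h /= /h_series.
    by case: eqP => //=; lia.
  rewrite /G mulrA (subzn im) -IH; apply: smul_local => t _.
    rewrite /h /= /h_series /=; congr (_%:R); lia.
  by rewrite h_part_cons mulrA subzn //; case: i {im} => i /=; lia.
rewrite (sum_ord_support Ga Gm) h_part_cons cperpM mulr_sumr coef_sum.
by apply: eq_bigr => i _; rewrite /G cperp_h (subzn (_ : (i <= m)%N)) // -ltnS.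
Qed.

(** Both sides count the nonnegative integer matrices with row sums [la] and column sums [mu];
    [smul_h_part] plays the role of transposition. *)
Lemma h_part_sym la mu : h_part F la mu = h_part F mu la.
Proof.
elim: mu la => [|m mu IH] la.
  elim: la => [|a la IH] //; rewrite h_part_cons coefM /= IH h_part_nil !coef1.
  by case: a => [|a] /=; rewrite ?mul1r ?mul0r.
rewrite h_part_cons coefM.
rewrite (smul_local (f' := h m) (g' := fun t => (1 * h_part F t) mu)) //.
  by rewrite smul_h_part mul1r.
by move=> t _; rewrite mul1r IH.
Qed.

Lemma h_part_span f :
  exists L : seq (F * seq nat), f = \sum_(x <- L) x.1 *: h_part F x.2.
Proof.
elim/Lam_ind: f => [|f g [L ->] [M ->]|c f [L ->]|r f [L ->]].
- by exists [:: (1, [::])]; rewrite big_seq1 h_part_nil scale1r.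
- by exists (L ++ M); rewrite big_cat.
- exists [seq (c * x.1, x.2) | x <- L]; rewrite big_map scaler_sumr.
  by apply: eq_bigr => x _; rewrite scalerA.
exists [seq (x.1, r :: x.2) | x <- L]; rewrite big_map mulr_sumr.
by apply: eq_bigr => x _; rewrite h_part_cons scalerAr.
Qed.

Lemma scalarD (w : Lam -> F) f g : scalar w -> w (f + g) = w f + w g.
Proof. by move=> /(_ 1 f g); rewrite scale1r mul1r. Qed.

Lemma scalarZ (w : Lam -> F) c f : scalar w -> w (c *: f) = c * w f.
Proof.
move=> sw; have /(_ (-1) 0 0) := sw; rewrite scaler0 addr0 mulN1r addNr => w0.
by rewrite -[c *: f]addr0 sw w0 addr0.
Qed.

(** An h-expansion of [u] is picked by choice; [hall_form_hr] shows that the value does not depend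
    on it. *)
Definition hall_form u g : F := \sum_(x <- sval (cid (h_part_span u))) x.1 * g x.2.

Lemma hall_form_linearr u : scalar (hall_form u).
Proof.
move=> c f g; rewrite /hall_form mulr_sumr -big_split.
by apply: eq_bigr => x _; rewrite coefD coefZ mulrDr mulrCA.
Qed.

Lemma hall_formDr u f g : hall_form u (f + g) = hall_form u f + hall_form u g.
Proof. exact/scalarD/hall_form_linearr. Qed.

Lemma hall_formZr u c f : hall_form u (c *: f) = c * hall_form u f.
Proof. exact/scalarZ/hall_form_linearr. Qed.

(** Symmetry of the coefficients turns the pairing with h_mu into a coefficient of [u], where the
    chosen expansion is no longer visible. *)
Lemma hall_form_hr u mu : hall_form u (h_part F mu) = u mu.
Proof.
rewrite /hall_form; case: cid => L uL; rewrite [in RHS]uL coef_sum.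
by apply: eq_bigr => x _; rewrite coefZ h_part_sym.
Qed.

Lemma h_part_ind (P : Lam -> Prop) :
    (forall mu, P (h_part F mu)) -> (forall f g, P f -> P g -> P (f + g)) ->
    (forall c f, P f -> P (c *: f)) ->
  forall f, P f.
Proof.
move=> Ph PD PZ f; have [L ->] := h_part_span f.
have P0 : P 0 by rewrite -(scale0r 1); apply: PZ; rewrite -h_part_nil.
by apply: big_ind => // x _; apply: PZ.
Qed.

Lemma hall_form_hl la g : hall_form (h_part F la) g = g la.
Proof.
elim/h_part_ind: g => [mu|f g IHf IHg|c f IHf].
- by rewrite hall_form_hr h_part_sym.
- by rewrite hall_formDr IHf IHg.
- by rewrite hall_formZr IHf.
Qed.

Lemma hall_form_linearl g : scalar (hall_form^~ g).
Proof.
move=> c u v; elim/h_part_ind: g => [mu|f g IHf IHg|d f IHf].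
- by rewrite !hall_form_hr.
- by rewrite !hall_formDr IHf IHg; ring.
- by rewrite !hall_formZr IHf; ring.
Qed.

Lemma hall_form_sym u v : hall_form u v = hall_form v u.
Proof.
elim/h_part_ind: v => [mu|f g IHf IHg|c f IHf].
- by rewrite hall_form_hr hall_form_hl.
- rewrite hall_formDr IHf IHg.
  by rewrite (scalarD (w := hall_form^~ u)) //; apply: hall_form_linearl.
- rewrite hall_formZr IHf.
  by rewrite (scalarZ (w := hall_form^~ u)) //; apply: hall_form_linearl.
Qed.

(** * Monomial functions and uniqueness of the Hall form *)

Definition part_of s := sort geq (nonzeros s).

Lemma part_of_partition s : is_partition (part_of s).
Proof.
rewrite /is_partition sort_sorted ?mem_sort ?nonzeros_notin //.
by move=> a b; apply: leq_total.
Qed.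

Lemma coef_part_of f s : f (part_of s) = f s.
Proof. by rewrite -(coef_nonzeros f s); apply: Lam_perm; rewrite perm_sort. Qed.

Lemma h_part_part_of s : h_part F (part_of s) = h_part F s.
Proof.
rewrite /h_part (perm_big _ (permEl (perm_sort _ _))) big_filter big_mkcond.
by apply: eq_bigr => -[].
Qed.

Lemma coef_m_part mu la : is_partition mu -> is_partition la ->
  m_part F mu la = (la == mu)%:R.
Proof.
move=> /andP[smu mu0] /andP[sla la0]; rewrite /m_part /= /m_series.
rewrite -/(nonzeros _) -/(nonzeros mu) !nonzeros_id //; congr (_%:R).
congr nat_of_bool; apply/idP/eqP => [|->//] pe.
apply: (sorted_eq (leT := geq)) => //; first by move=> a b c ba cb; apply: leq_trans ba.
by move=> a b; rewrite andbC; apply: anti_leq.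
Qed.

Lemma finite_positive_seqs d :
  exists L : seq (seq nat), forall s, 0%N \notin s -> (sumn s <= d)%N -> s \in L.
Proof.
elim: d => [|d [L IH]].
  by exists [:: [::]] => -[|[|a] s].
exists ([::] :: [seq a :: s | a <- iota 0 d.+2, s <- L]) => -[|[|a] s] //.
rewrite [_ \in a.+1 :: s]inE => s0 sd; rewrite inE.
apply/orP; right; apply/allpairsP; exists (a.+1, s); split=> //.
  by rewrite mem_iota; move: sd; rewrite /=; lia.
by apply: IH => //; move: sd; rewrite /=; lia.
Qed.

(** The partitions in the support of [f] lie in a finite list; subtracting a multiple of m_nu clears
    the head nu of that list. *)
Lemma m_part_ind (P : Lam -> Prop) :
    (forall mu, is_partition mu -> P (m_part F mu)) ->
    (forall f g, P f -> P g -> P (f + g)) ->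
    (forall c f, P f -> P (c *: f)) ->
  forall f, P f.
Proof.
move=> Pm PD PZ f.
have [d sf] := smallP f; have [L Ld] := finite_positive_seqs d.
have {sf Ld} : forall mu, is_partition mu -> f mu != 0 -> mu \in L.
  move=> mu /andP[_ mu0] fmu; apply: Ld => //.
  by apply: contraNT fmu => ds; rewrite sf //; lia.
elim: L f => [|nu L IH] f fL.
  suff -> : f = 0 *: m_part F [::] by apply/PZ/Pm.
  apply: LamE => s; rewrite scale0r -coef_part_of.
  by apply/eqP; apply: contraT => /(fL _ (part_of_partition s)).
have [pnu|npnu] := boolP (is_partition nu); last first.
  apply: IH => mu pmu /(fL _ pmu); rewrite inE => /orP[/eqP mE|//].
  by rewrite -mE pmu in npnu.
pose c : F := f nu.
have -> : f = (c *: m_part F nu) + (f - c *: m_part F nu) by rewrite addrC subrK.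
apply: PD; first exact/PZ/Pm.
apply: IH => mu pmu; rewrite coefB coefZ coef_m_part //.
have [->|ne] := eqVneq mu nu; first by rewrite mulr1 subrr eqxx.
by rewrite mulr0 subr0 => /(fL _ pmu); rewrite inE (negPf ne).
Qed.

Lemma hall_form_is_hall : is_hall hall_form.
Proof.
split; [exact: hall_form_linearr|exact: hall_form_linearl|].
by move=> la mu pla pmu; rewrite hall_form_hl coef_m_part.
Qed.

Lemma is_hall_unique b : is_hall b -> forall u v, b u v = hall_form u v.
Proof.
move=> [br bl bhm] u v.
elim/h_part_ind: u => [la|f g IHf IHg|c f IHf].
- rewrite -h_part_part_of; elim/m_part_ind: v => [mu pmu|f g IHf IHg|c f IHf].
  + by rewrite bhm ?part_of_partition // hall_form_hl coef_m_part ?part_of_partition.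
  + by rewrite (scalarD _ _ (br _)) hall_formDr IHf IHg.
  + by rewrite (scalarZ _ _ (br _)) hall_formZr IHf.
- by rewrite (scalarD _ _ (bl v)) (scalarD _ _ (hall_form_linearl v)) IHf IHg.
- by rewrite (scalarZ _ _ (bl v)) (scalarZ _ _ (hall_form_linearl v)) IHf.
Qed.

Lemma hallE u v : hall u v = hall_form u v.
Proof.
apply: is_hall_unique; rewrite /hall.
by case: xgetP => [b -> //|/(_ hall_form)/(_ hall_form_is_hall)].
Qed.

(** * Adjoints of multiplication operators *)

Lemma hallDr u f g : hall u (f + g) = hall u f + hall u g.
Proof. by rewrite !hallE hall_formDr. Qed.

Lemma hallZr u c f : hall u (c *: f) = c * hall u f.
Proof. by rewrite !hallE hall_formZr. Qed.

Lemma hall_sym u v : hall u v = hall v u.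
Proof. by rewrite !hallE hall_form_sym. Qed.

Lemma hallDl f g u : hall (f + g) u = hall f u + hall g u.
Proof. by rewrite !(hall_sym _ u) hallDr. Qed.

Lemma hallZl c f u : hall (c *: f) u = c * hall f u.
Proof. by rewrite !(hall_sym _ u) hallZr. Qed.

Lemma hall_h_part la g : hall (h_part F la) g = g la.
Proof. by rewrite hallE hall_form_hl. Qed.

Lemma hall_inj v w : (forall u, hall u v = hall u w) -> v = w.
Proof. by move=> vw; apply: LamE => s; rewrite -!hall_h_part. Qed.

(** For r >= 0 and u = h_la both sides are the coefficient of [v] at [r :: la]. *)
Lemma hall_h (r : int) u v : hall (h r * u) v = hall u (cperp r v).
Proof.
case: r => r; last by rewrite cperp_neg // mul0r -(scale0r 0) hallZl mul0r
  -(scale0r 0) hallZr mul0r.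
elim/h_part_ind: u => [la|f g IHf IHg|c f IHf].
- by rewrite -h_part_cons !hall_h_part cperpE.
- by rewrite mulrDr !hallDl IHf IHg.
- by rewrite -scalerAr !hallZl IHf.
Qed.

(** [hall_h] provides the adjoint of each h_r, and existence passes to sums, scalar multiples and
    products. *)
Lemma adjoint_exists f : exists A, is_adjoint (fun u => f * u) A.
Proof.
elim/Lam_ind: f => [|f g [A aA] [B aB]|c f [A aA]|r f [A aA]].
- by exists id => u v; rewrite mul1r.
- by exists (fun v => A v + B v) => u v; rewrite mulrDl hallDl hallDr aA aB.
- by exists (fun v => c *: A v) => u v; rewrite -scalerAl hallZl hallZr aA.
- by exists (fun v => A (cperp r v)) => u v; rewrite -mulrA hall_h aA.
Qed.

Lemma hall_perp f u v : hall (f * u) v = hall u (perp f v).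
Proof.
rewrite /perp; case: xgetP => [A -> //|nA].
by have [A /(nA A)] := adjoint_exists f.
Qed.

Lemma perpP f v w : (forall u, hall (f * u) v = hall u w) -> perp f v = w.
Proof. by move=> fw; apply: hall_inj => u; rewrite -hall_perp. Qed.

Lemma perp_is_linear f : linear (perp f).
Proof.
by move=> c u v; apply: perpP => w; rewrite !hallDr !hallZr !hall_perp.
Qed.
HB.instance Definition _ f := GRing.isLinear.Build F Lam Lam *:%R (perp f)
  (perp_is_linear f).

Lemma perp_h r v : perp (h r) v = cperp r v.
Proof. by apply: perpP => u; rewrite hall_h. Qed.

Lemma perp1 v : perp 1 v = v.
Proof. by apply: perpP => u; rewrite mul1r. Qed.

Lemma perpDl f g v : perp (f + g) v = perp f v + perp g v.
Proof. by apply: perpP => u; rewrite mulrDl hallDl hallDr !hall_perp. Qed.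

Lemma perpZl c f v : perp (c *: f) v = c *: perp f v.
Proof. by apply: perpP => u; rewrite -scalerAl hallZl hallZr !hall_perp. Qed.

Lemma perp0l v : perp 0 v = 0.
Proof. by have := perpZl 0 0 v; rewrite !scale0r. Qed.

Lemma perpMl f g v : perp (f * g) v = perp f (perp g v).
Proof. by apply: perpP => u; rewrite mulrAC mulrC !hall_perp. Qed.

Lemma perpC f g v : perp f (perp g v) = perp g (perp f v).
Proof. by rewrite -!perpMl mulrC. Qed.

Lemma perp_suml (I : Type) (r : seq I) (P : pred I) (G : I -> Lam) v :
  perp (\sum_(i <- r | P i) G i) v = \sum_(i <- r | P i) perp (G i) v.
Proof.
by elim/big_rec2: _ => [|i f g _ <-]; rewrite ?perp0l ?perpDl.
Qed.

Lemma perp_sum (I : Type) (r : seq I) (P : pred I) (G : I -> Lam) f :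
  perp f (\sum_(i <- r | P i) G i) = \sum_(i <- r | P i) perp f (G i).
Proof. exact: raddf_sum. Qed.

Lemma perpD f u v : perp f (u + v) = perp f u + perp f v.
Proof. exact: raddfD. Qed.

Lemma perpZ f c v : perp f (c *: v) = c *: perp f v.
Proof. exact: linearZ. Qed.

(** Transpose of [cperp_eM] under the symmetric Hall form. *)
Lemma perp_e_hM r n f :
  perp (e r) (h n * f) = h n * perp (e r) f + h (n - 1) * perp (e (r - 1)) f.
Proof.
apply: perpP => u; rewrite hallDr [hall u (h n * _)]hall_sym hall_h.
rewrite [hall u _]hall_sym hall_h !(hall_sym (perp _ _)) -!hall_perp.
by rewrite hall_sym hall_h cperp_eM hallDr !(hall_sym f).
Qed.

End Hall.

(** * Commutation of the operators B *)

Section Operators.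

Variable F : fieldType.
Local Notation Lam := (Lam F).
Local Notation h := (@h F).
Local Notation e := (@e F).
Implicit Types (f g u v : Lam) (s t : seq nat).
Variable q : F.

Lemma fsum_nat (V : nmodType) (G : nat -> V) N :
  (forall i, (N <= i)%N -> G i = 0) ->
  \sum_(i \in [set: nat]) G i = \sum_(i < N) G i.
Proof.
move=> G0; rewrite (@fsbigE _ _ _ _ _ (iota 0 N)) ?iota_uniq //.
  rewrite -(big_mkord xpredT) /index_iota subn0.
  by apply: eq_bigl => i; rewrite classical_sets.in_setT.
by move=> i _; rewrite mem_iota add0n /= -leqNgt; apply: G0.
Qed.

Lemma sum_diagonal (V : nmodType) (T : nat -> nat -> V) N :
    (forall j r, (N <= j + r)%N -> T j r = 0) ->
  \sum_(j < N) \sum_(r < N) T j r = \sum_(k < N) \sum_(r < k.+1) T (k - r)%N r.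
Proof.
move=> T0; have -> : forall M, \sum_(k < M) \sum_(r < k.+1) T (k - r)%N r
    = \sum_(r < M) \sum_(j < M - r) T j r.
  elim=> [|M IH]; first by rewrite !big_ord0.
  rewrite big_ord_recr IH /= [\sum_(r < M.+1) T _ _]big_ord_recr addrA -big_split /=.
  rewrite [RHS]big_ord_recr /= subnn subSnn big_ord1; congr (_ + _).
  by apply: eq_bigr => r _; rewrite subSn 1?ltnW // big_ord_recr.
rewrite exchange_big; apply: eq_bigr => r _.
by apply: (sum_ord_support (G := fun j => T j r)) => j jN; apply: T0; lia.
Qed.

Lemma small0 f : small f 0 -> f = 0.
Proof. by move=> sf; apply: LamE => s; apply: sf. Qed.

Lemma small_sum (I : Type) (r : seq I) (p : pred I) (G : I -> Lam) d :
  (forall i, p i -> small (G i) d) -> small (\sum_(i <- r | p i) G i) d.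
Proof.
move=> sG; apply: (big_ind (fun f => small f d)) => //.
by move=> f g; apply: smallD.
Qed.

Lemma small_cperp (j : nat) f d : small f d -> small (cperp j f) (d - j).
Proof. by move=> sf s ds; rewrite cperpE sf //=; lia. Qed.

(** [sum_eh] is solved for its last e, and the adjoint of h_j lowers degrees by j. *)
Lemma small_perp_e (r : nat) f d : small f d -> small (perp (e r) f) (d - r).
Proof.
elim/ltn_ind: r f => -[|r] IH f sf; first by rewrite e0 perp1 subn0.
have /eqP := sum_eh F r.+1; rewrite big_ord_recr /= subrr mulr1 addrC.
rewrite addr_eq0 => /eqP /(congr1 (fun g => (-1) ^+ r.+1 *: g)).
rewrite scalerA -expr2 sqrr_sign scale1r => ->.
rewrite perpZl -scaleN1r perpZl perp_suml; apply/smallZ/smallZ/small_sum => i _.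
rewrite perpZl mulrC perpMl perp_h subzn; last exact/ltnW.
have -> : (d - r.+1 = d - i - (r.+1 - i))%N by have := ltn_ord i; lia.
exact/smallZ/small_cperp/IH.
Qed.

(* The coefficient of z^(-k) in f[X - (1 - q) / z]. *)
Definition opP (k : int) f : Lam :=
  if k is Posz n then \sum_(r < n.+1) ((-1) ^+ r * q ^+ (n - r)) *:
    perp (e (Posz r)) (perp (h (n%:Z - r%:Z)) f)
  else 0.
Arguments opP : simpl never.

Lemma opP_neg k f : k < 0 -> opP k f = 0.
Proof. by case: k. Qed.

Lemma opP0 f : opP 0 f = f.
Proof. by rewrite /opP /= big_ord1 e0 subrr h0 !perp1 !mulr1 scale1r. Qed.

Lemma opP_is_linear k : linear (opP k).
Proof.
case: k => k c f g; rewrite /opP ?scaler0 ?addr0 //.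
rewrite scaler_sumr -big_split; apply: eq_bigr => r _.
by rewrite !perpD !perpZ scalerDr !scalerA [c * _]mulrC.
Qed.
HB.instance Definition _ k := GRing.isLinear.Build F Lam Lam *:%R (opP k)
  (opP_is_linear k).

Lemma opPZ k c f : opP k (c *: f) = c *: opP k f.
Proof. exact: linearZ. Qed.

Lemma opP_sum k (I : Type) (r : seq I) (P : pred I) (G : I -> Lam) :
  opP k (\sum_(i <- r | P i) G i) = \sum_(i <- r | P i) opP k (G i).
Proof. exact: raddf_sum. Qed.

Lemma opP_perp k f g : opP k (perp f g) = perp f (opP k g).
Proof.
case: k => k; rewrite /opP; last by rewrite raddf0.
rewrite perp_sum; apply: eq_bigr => r _.
by rewrite perpZ ![perp f (perp _ _)]perpC.
Qed.

Lemma opPC k l f : opP k (opP l f) = opP l (opP k f).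
Proof.
case: l => l; last by rewrite raddf0.
rewrite [opP l (opP k f)]/opP [opP l f]/opP opP_sum; apply: eq_bigr => r _.
by rewrite opPZ !opP_perp.
Qed.

Lemma small_opP_sub (k : nat) f d : small f d -> small (opP k f) (d - k).
Proof.
move=> sf; apply: small_sum => r _; apply: smallZ.
have rk : (r <= k)%N by rewrite -ltnS.
have -> : (d - k = d - (k - r) - r)%N by lia.
by apply: small_perp_e; rewrite perp_h subzn //; apply: small_cperp.
Qed.

Lemma small_opP (k : nat) f d : small f d -> small (opP k f) d.
Proof. by move/(small_opP_sub (k := k)); apply: small_leq; lia. Qed.

(** The factor q aligns the coefficients of the two sums on the left. Their difference simplifies
    termwise by [cperp_hM], and [perp_e_hM] then splits it into the two sums on the right. *)
Lemma opP_hM (k n : int) f :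
  opP k (h n * f) - q *: opP (k - 1) (h (n - 1) * f)
  = h n * opP k f - h (n - 1) * opP (k - 1) f.
Proof.
case: k => [[|k]|k]; last by rewrite !opP_neg ?mulr0 ?scaler0 //; lia.
  by rewrite !opP0 !opP_neg // mulr0 scaler0.
have -> : k.+1%:Z - 1 = k by lia.
(* The coefficients of P_(k+1); for r <= k they are q times those of P_k, and at r = k + 1 the
   adjoint of h_(-1) is zero. *)
pose c r : F := (-1) ^+ r * q ^+ (k.+1 - r).
have qc g : q *: opP k g = \sum_(r < k.+2) c r *:
    perp (e (Posz r)) (cperp (k%:Z - r%:Z) g).
  rewrite big_ord_recr /= cperp_neg; last lia.
  rewrite raddf0 scaler0 addr0 scaler_sumr; apply: eq_bigr => r _.
  rewrite perp_h scalerA; congr (_ *: _); rewrite /c mulrCA -exprS.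
  by rewrite subSn // -ltnS.
rewrite qc /opP -/(opP k f) -sumrB.
under eq_bigr => r _.
  rewrite -scalerBr -raddfB /= perp_h cperp_hM.
  rewrite (_ : k.+1%:Z - r%:Z - 1 = k%:Z - r%:Z) ?addrK; last lia.
  rewrite perp_e_hM scalerDr; over.
rewrite /= big_split /=; congr (_ + _).
  by rewrite mulr_sumr; apply: eq_bigr => r _; rewrite scalerAr perp_h.
rewrite big_ord_recl e_neg // perp0l mulr0 scaler0 add0r.
rewrite -mulrN -sumrN mulr_sumr; apply: eq_bigr => r _.
rewrite perp_h scalerAr -scaleNr; congr (_ * (_ *: perp (e _) (cperp _ f))).
- by rewrite /c lift0 exprS subSS mulN1r mulNr.
- by rewrite lift0; lia.
- by rewrite lift0; lia.
Qed.

Lemma opSE a f d N : small f d -> (d <= N)%N ->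
  opS a f = \sum_(r < N) (-1) ^+ r *: (h (a + Posz r) * perp (e (Posz r)) f).
Proof.
move=> sf dN; rewrite /opS (fsum_nat (N := N)) // => r Nr.
rewrite (small0 (f := perp _ _)) ?mulr0 ?scaler0 //.
by apply: small_leq (small_perp_e (r := r) sf); lia.
Qed.

(** Groups the double sum defining B_a by k = r + j; terms with r + j >= d vanish for degree
    reasons. *)
Lemma opBE a f d N : small f d -> (d <= N)%N ->
  opB q a f = \sum_(k < N) h (a + Posz k) * opP k f.
Proof.
move=> sf dN; have sh (j : nat) : small (perp (h j) f) (d - j).
  by rewrite perp_h; apply: small_cperp.
rewrite /opB (fsum_nat (N := N)); last first.
  move=> j jN; rewrite (small0 (f := perp _ _)); last by apply: small_leq (sh j); lia.
  rewrite (@opSE _ _ 0 0) // ?big_ord0 ?scaler0 // => s; exact: coef0.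
pose T j r : Lam := q ^+ j *:
  ((-1) ^+ r *: (h (a + Posz j + Posz r) * perp (e (Posz r)) (perp (h (Posz j)) f))).
transitivity (\sum_(j < N) \sum_(r < N) T j r).
  apply: eq_bigr => j _; rewrite (@opSE _ _ (d - j) N) //; last lia.
  by rewrite scaler_sumr.
rewrite sum_diagonal => [|j r jr].
  apply: eq_bigr => k _; rewrite /opP mulr_sumr; apply: eq_bigr => r _.
  have rk : (r <= k)%N by rewrite -ltnS.
  rewrite /T -addrA subzn // -scalerAr scalerA mulrC; congr (_ *: (h _ * _)).
  by rewrite -PoszD subnK.
rewrite /T (small0 (f := perp _ (perp _ _))) ?mulr0 ?scaler0 //.
by apply: small_leq (small_perp_e (r := r) (sh j)); lia.
Qed.

Lemma opB_is_linear a : linear (opB q a).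
Proof.
move=> c f g; have [d sf] := smallP f; have [d' sg] := smallP g.
have sf' := small_leq (leq_maxl d d') sf; have sg' := small_leq (leq_maxr d d') sg.
rewrite !(opBE (d := maxn d d') a (N := maxn d d')) //; last exact/smallD/sg'/smallZ.
rewrite scaler_sumr -big_split; apply: eq_bigr => k _.
by rewrite linearP mulrDr scalerAr.
Qed.
HB.instance Definition _ a := GRing.isLinear.Build F Lam Lam *:%R (opB q a)
  (opB_is_linear a).

Lemma opBD a f g : opB q a (f + g) = opB q a f + opB q a g.
Proof. exact: raddfD. Qed.

Lemma opBN a f : opB q a (- f) = - opB q a f.
Proof. exact: raddfN. Qed.

Lemma opBZ a c f : opB q a (c *: f) = c *: opB q a f.
Proof. exact: linearZ. Qed.

Lemma opB_sum a (I : Type) (r : seq I) (P : pred I) (G : I -> Lam) :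
  opB q a (\sum_(i <- r | P i) G i) = \sum_(i <- r | P i) opB q a (G i).
Proof. exact: raddf_sum. Qed.

Lemma opB_hM (m n : int) f :
  opB q m (h n * f) - q *: opB q (m + 1) (h (n - 1) * f)
  = h n * opB q m f - h (n - 1) * opB q (m + 1) f.
Proof.
have [d1 s1] := smallP (h n * f); have [d2 s2] := smallP (h (n - 1) * f).
have [d3 s3] := smallP f.
pose N := maxn d1 (maxn d2 d3).
(* Rewrites B_(m+1) over the same h_(m+k) as B_m, at the price of a shift in P and of one more
   term. *)
have sB g : small g N ->
    opB q (m + 1) g = \sum_(k < N.+1) h (m + Posz k) * opP (k%:Z - 1) g.
  move=> sg; rewrite (opBE _ sg (leqnn _)) big_ord_recl opP_neg // mulr0 add0r.
  by apply: eq_bigr => k _; rewrite lift0; congr (h _ * opP _ _); lia.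
have {}s1 := small_leq (leq_maxl _ _ : (d1 <= N)%N) s1.
have {}s2 : small (h (n - 1) * f) N by apply: small_leq s2; lia.
have {}s3 : small f N by apply: small_leq s3; lia.
rewrite !sB // (opBE _ s1 (leqnSn _)) (opBE _ s3 (leqnSn _)).
rewrite scaler_sumr !mulr_sumr -!sumrB; apply: eq_bigr => k _.
by rewrite scalerAr -mulrBr opP_hM mulrBr; congr (_ - _); rewrite mulrCA.
Qed.

(* The factor h(n+l) h(m+k) - h(n+l-1) h(m+k+1) changes sign under
   (m, k, n, l) -> (n-1, l, m+1, k), which is why [opB_comm] holds. *)
Lemma opBB_sum (m n : int) f N : small f N ->
  opB q m (opB q n f) - q *: opB q (m + 1) (opB q (n - 1) f)
  = \sum_(l < N) \sum_(k < N)
      (h (n + l%:Z) * h (m + k%:Z) - h (n + l%:Z - 1) * h (m + 1 + k%:Z))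
        * opP k (opP l f).
Proof.
move=> sf; rewrite !(opBE _ sf (leqnn N)) !opB_sum scaler_sumr -sumrB.
apply: eq_bigr => l _; rewrite (_ : n - 1 + l%:Z = n + l%:Z - 1); last lia.
rewrite opB_hM !(opBE _ (small_opP l sf) (leqnn N)) !mulr_sumr -sumrB.
by apply: eq_bigr => k _; rewrite !mulrA mulrBl.
Qed.

Lemma opB_comm (m n : int) f :
  opB q m (opB q n f) - q *: opB q (m + 1) (opB q (n - 1) f)
  = q *: opB q n (opB q m f) - opB q (n - 1) (opB q (m + 1) f).
Proof.
have [N sf] := smallP f; apply: oppr_inj; rewrite [RHS]opprB.
(* The negated right side is the left side taken at (n - 1, m + 1), so [opBB_sum] covers both. *)
have := opBB_sum (n - 1) (m + 1) sf; rewrite subrK addrK => ->.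
rewrite (opBB_sum _ _ sf) exchange_big -sumrN; apply: eq_bigr => l _.
rewrite -sumrN; apply: eq_bigr => k _; rewrite opPC -mulNr opprB.
congr (_ * _); congr (_ - _); rewrite mulrC; congr (h _ * h _); lia.
Qed.

End Operators.

(** * The case of columns and rows of length two *)

Section Columns.

Variable F : fieldType.
Local Notation Lam := (Lam F).
Local Notation h := (@h F).
Implicit Types (f g u v : Lam) (s t : seq nat).
Variable q : F.
Local Notation B := (opB q).

Lemma opB_one a : B a 1 = h a.
Proof.
rewrite (@opBE F q a 1 1 1) //; first by rewrite big_ord1 addr0 opP0 mulr1.
by move=> s; rewrite coef1; case: eqP => //; lia.
Qed.

Hypothesis two_neq0 : 2%:R != 0 :> F.

(** At n = m + 1 the two sides of [opB_comm] are opposite, so twice the difference vanishes; this is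
    where 2 must be invertible. *)
Lemma opB_succ m f : B m (B (m + 1) f) = q *: B (m + 1) (B m f).
Proof.
have := opB_comm q m (m + 1) f; rewrite addrK -[RHS]opprB => /eqP.
rewrite -subr_eq0 opprK -mulr2n -scaler_nat scaler_eq0 (negPf two_neq0) /=.
by rewrite subr_eq0 => /eqP.
Qed.

Lemma opBB1 a f : opBB q [:: a] f = B (Posz a) f.
Proof.
rewrite /opBB (bigD1 (1%g : 'S_1)) //= big1 => [|s]; last by rewrite [s]permS1 eqxx.
rewrite odd_perm1 expr0 scale1r addr0 enum_ordSl /= enum_ord0 /= perm1.
by rewrite addr0 subr0.
Qed.

Lemma opBB11 f : opBB q [:: 1; 1]%N f = B 1 (B 1 f) - B 2 (B 0 f).
Proof.
pose t : 'S_2 := tperm ord0 (lift ord0 ord0).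
have t1 : t != 1%g.
  by apply/eqP => /permP /(_ ord0); rewrite tpermL perm1.
rewrite /opBB (bigD1 (1%g : 'S_2)) //= (bigD1 t) //= big1 => [|s /andP[s1 st]].
  rewrite odd_perm1 odd_tperm expr0 expr1 !scale1r scaleN1r addr0.
  rewrite !enum_ordSl enum_ord0 /= !perm1 tpermL tpermR /=.
  by [].
exfalso; have ord2 (i : 'I_2) : i = ord0 \/ i = lift ord0 ord0.
  by case: i => -[|[|//]] Hi; [left|right]; apply: val_inj.
have [s0|s0] := ord2 (s ord0); have [s1'|s1'] := ord2 (s (lift ord0 ord0)).
- by have := perm_inj (etrans s0 (esym s1')).
- case/eqP: s1; apply/permP => i; rewrite perm1.
  by case: (ord2 i) => ->.
- case/eqP: st; apply/permP => i.
  by case: (ord2 i) => ->; rewrite /t ?tpermL ?tpermR.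
- by have := perm_inj (etrans s0 (esym s1')).
Qed.

(** Turns scalars into ring elements, so that [ring] decides identities between linear
    combinations. *)
Lemma scale_in_alg (c : F) f : c *: f = GRing.in_alg Lam c * f.
Proof. by rewrite in_algE mulr_algl. Qed.

(** * Relations between B_0, B_1, B_2 and B_(1,1) *)

Local Notation BB f := (B 1 (B 1 f) - B 2 (B 0 f)).

Lemma opB01 f : B 0 (B 1 f) = q *: B 1 (B 0 f).
Proof. exact: (opB_succ 0). Qed.

Lemma opB12 f : B 1 (B 2 f) = q *: B 2 (B 1 f).
Proof. exact: (opB_succ 1). Qed.

(** Jing's relation at (0, 2), with B_1 B_1 replaced by B_(1,1) + B_2 B_0. *)
Lemma opB02 f : B 0 (B 2 f) = (2 * q - 1) *: B 2 (B 0 f) + (q - 1) *: BB f.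
Proof.
have /eqP := opB_comm q 0 2 f; rewrite subr_eq => /eqP ->.
rewrite -[2 - 1]/(1 : int) -[0 + 1]/(1 : int).
by rewrite !scale_in_alg; ring.
Qed.

(** The mixed terms B_2 B_0 B_1 and B_1 B_2 B_0 both equal q B_2 B_1 B_0. *)
Lemma opBB_opB1 f : BB (B 1 f) = B 1 (BB f).
Proof. by rewrite opBD opBN opB01 opB12 opBZ. Qed.

(** Brings B_2 to the front, so that the image of B_2 is stable under B_(1,1). [opB0_opBB] is the
    mirror image, with the same scalars. *)
Lemma opBB_opB2 f : BB (B 2 f) =
  B 2 ((q ^+ 2 - q + 1) *: BB f + (q - 1) ^+ 2 *: B 2 (B 0 f)).
Proof.
rewrite opB02 opB12 !(opBD, opBN, opBZ) opB12.
by rewrite !scale_in_alg; ring.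
Qed.

Lemma opB0_opBB f : B 0 (BB f) =
  (q ^+ 2 - q + 1) *: BB (B 0 f) + (q - 1) ^+ 2 *: B 2 (B 0 (B 0 f)).
Proof.
rewrite opBD opBN opB02 opB01 opB01 opBZ.
by rewrite !scale_in_alg; ring.
Qed.

(** This is C_(1^n): the 2-split of (1^n) cuts off pairs, leaving a single 1 at the end when n is
    odd. *)
Fixpoint ones (n : nat) : Lam :=
  match n with
  | 0 => 1
  | 1 => B 1 1
  | n.+2 => BB (ones n)
  end.
Arguments ones : simpl never.

Lemma onesSS n : ones n.+2 = BB (ones n).
Proof. by []. Qed.

Definition twos a b : Lam := iter a (B 2) (ones b).

Lemma twosS a b : twos a.+1 b = B 2 (twos a b).
Proof. by []. Qed.

(** The span of the words B_2^a B_(1,1)^b (1) with a + b = d, which houses the correction terms of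
    [opB1_ones]. *)
Definition even_span d f :=
  exists c : nat -> F, f = \sum_(a < d.+1) c a *: twos a (d - a).*2.

Lemma even_spanD d f g : even_span d f -> even_span d g -> even_span d (f + g).
Proof.
move=> [c ->] [c' ->]; exists (fun a => c a + c' a).
by rewrite -big_split; apply: eq_bigr => a _; rewrite scalerDl.
Qed.

Lemma even_spanZ d x f : even_span d f -> even_span d (x *: f).
Proof.
move=> [c ->]; exists (fun a => x * c a).
by rewrite scaler_sumr; apply: eq_bigr => a _; rewrite scalerA.
Qed.

Lemma even_span0 d : even_span d 0.
Proof. by exists (fun=> 0); rewrite big1 // => a _; rewrite scale0r. Qed.

Lemma even_span_twos d a b : (a + b)%N = d -> even_span d (twos a b.*2).
Proof.
move=> abd; exists (fun i => (i == a)%:R).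
have ad : (a < d.+1)%N by lia.
rewrite (bigD1 (Ordinal ad)) //= eqxx scale1r big1 ?addr0 => [|i].
  by congr (twos _ _.*2); lia.
by rewrite -val_eqE /= => /negPf ->; rewrite scale0r.
Qed.

Lemma even_span_ind d (P : Lam -> Prop) :
    (forall f g, P f -> P g -> P (f + g)) -> (forall x f, P f -> P (x *: f)) ->
    (forall a b, (a + b)%N = d -> P (twos a b.*2)) ->
  forall f, even_span d f -> P f.
Proof.
move=> PD PZ Pt f [c ->].
have P0 : P 0 by rewrite -(scale0r (twos d 0.*2)); apply/PZ/Pt; rewrite addn0.
apply: big_ind => // a _; apply/PZ/Pt; have := ltn_ord a; lia.
Qed.

Lemma even_span_opB2 d f : even_span d f -> even_span d.+1 (B 2 f).
Proof.
elim/even_span_ind => [u v|x u|a b abd]; rewrite ?opBD ?opBZ.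
- exact: even_spanD.
- exact: even_spanZ.
by rewrite -twosS; apply: even_span_twos; rewrite -abd.
Qed.

(** Joint induction: [opB02], [opB0_opBB] and [opBB_opB2] push B_0 and B_(1,1) past the first
    operator of a word, after which they act on shorter words. *)
Lemma even_span_closed d :
  (forall f, even_span d f -> even_span d (B 0 f)) /\
  (forall f, even_span d f -> even_span d.+1 (BB f)).
Proof.
elim: d => [|d [IH0 IHB]]; split; apply: even_span_ind.
- by move=> u v uW vW; rewrite opBD; apply: even_spanD.
- by move=> x u uW; rewrite opBZ; apply: even_spanZ.
- case=> [|//] [|//] _; rewrite (_ : B 0 _ = twos 0 0.*2); first exact: even_span_twos.
  exact: opB_one.
- by move=> u v uW vW; rewrite !opBD opprD addrACA; apply: even_spanD.
- by move=> x u uW; rewrite !opBZ -scalerBr; apply: even_spanZ.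
- by case=> [|//] [|//] _; apply: (@even_span_twos 1 0 1).
- by move=> u v uW vW; rewrite opBD; apply: even_spanD.
- by move=> x u uW; rewrite opBZ; apply: even_spanZ.
- case=> [|a] b abd.
    case: b abd => [|b] // [bd].
    rewrite [twos _ _]/(BB (ones b.*2)) opB0_opBB.
    have wb : even_span d (ones b.*2) by apply: (@even_span_twos d 0 b).
    apply: even_spanD; apply: even_spanZ; first exact/IHB/IH0.
    exact/even_span_opB2/IH0/IH0.
  have w : even_span d (twos a b.*2) by apply: even_span_twos; lia.
  rewrite twosS opB02.
  by apply: even_spanD; apply: even_spanZ; [apply/even_span_opB2/IH0|apply/IHB].
- by move=> u v uW vW; rewrite !opBD opprD addrACA; apply: even_spanD.
- by move=> x u uW; rewrite !opBZ -scalerBr; apply: even_spanZ.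
case=> [|a] b abd; first by apply: (@even_span_twos _ 0 b.+1); lia.
have w : even_span d (twos a b.*2) by apply: even_span_twos; lia.
rewrite twosS opBB_opB2; apply: even_span_opB2.
by apply: even_spanD; apply: even_spanZ; [apply/IHB|apply/even_span_opB2/IH0].
Qed.

(** For even n there is no correction, since B_1 commutes with B_(1,1). For odd n the correction
    arises at n = 1 and is carried along by [opBB_opB2]. *)
Lemma opB1_ones n : exists f d, even_span d f /\ B 1 (ones n) = ones n.+1 + B 2 f.
Proof.
suff main p : B 1 (ones p.*2) = ones p.*2.+1 /\
    exists f, even_span p f /\ B 1 (ones p.*2.+1) = ones p.*2.+2 + B 2 f.
  have [B1even [f [fW B1odd]]] := main n./2.
  have := odd_double_half n; case: (odd n) => nE.
    by exists f, n./2; rewrite -[in ones n]nE -[in ones n.+1]nE.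
  exists 0, 0%N; split; first exact: even_span0.
  by rewrite -[in ones n]nE -[in ones n.+1]nE add0n B1even raddf0 addr0.
elim: p => [|p [IHe [f [fW IHo]]]].
  (* B_1 B_1 (1) = B_(1,1) (1) + B_2 B_0 (1), and B_0 (1) = h_0 = 1. *)
  split=> //; exists 1; split; first exact: (@even_span_twos 0 0 0).
  by rewrite [ones 0.*2.+2]/(BB 1) (opB_one 0) subrK.
have oddE : B 1 (ones p.+1.*2) = ones p.+1.*2.+1.
  by rewrite doubleS !onesSS -opBB_opB1 IHe.
(* The witness is what remains behind B_2 when B_(1,1) passes the old correction B_2 f. *)
split=> //; exists ((q ^+ 2 - q + 1) *: BB f + (q - 1) ^+ 2 *: B 2 (B 0 f)).
have [W0 WB] := even_span_closed p; split.
  by apply: even_spanD; apply: even_spanZ; [apply: WB|apply/even_span_opB2/W0].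
rewrite -opBB_opB2 doubleS [in LHS]onesSS -opBB_opB1 IHo [ones p.*2.+4]onesSS.
by rewrite !opBD opprD addrACA.
Qed.

End Columns.

(** * 2-Schur functions *)

Section TwoSchur.

Variable F : fieldType.
Local Notation Lam := (Lam F).
Local Notation h := (@h F).
Implicit Types (f g u v : Lam) (s t : seq nat).
Variable q : F.
Local Notation B := (opB q).
Arguments ones : simpl never.

(** * The 2-split of (2^a, 1^b) *)

Lemma segment_lengthE k la j : (j <= size la)%N -> (hook (take j la) <= k)%N ->
    (forall i, (j < i <= size la)%N -> (k < hook (take i la))%N) ->
  segment_length k la = j.
Proof.
move=> js hj hi; apply/eqP; rewrite eqn_leq; apply/andP; split.
  apply/bigmax_leqP => i hik; rewrite leqNgt; apply/negP => ji.
  by move: hik; rewrite leqNgt hi // ji -ltnS ltn_ord.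
have js' : (j < (size la).+1)%N by [].
exact: (@leq_bigmax_cond _ _ (fun i : 'I_(size la).+1 => nat_of_ord i) (Ordinal js')).
Qed.

Lemma hook_take j a la : (0 < j <= (size la).+1)%N ->
  hook (take j (a :: la)) = (a + j - 1)%N.
Proof.
by case: j => // j js; rewrite /hook /= size_takel //; lia.
Qed.

Lemma segment_length_2 la : segment_length 2 (2%N :: la) = 1%N.
Proof. by apply: segment_lengthE => [||i /= ij] //; rewrite hook_take //=; lia. Qed.

Lemma segment_length_1 b : segment_length 2 (nseq b.+1 1%N) = minn b.+1 2.
Proof.
apply: segment_lengthE; rewrite ?size_nseq; first lia.
  by rewrite hook_take ?size_nseq; lia.
by move=> i /= ib; rewrite hook_take ?size_nseq; lia.
Qed.

(** The fuel [n] is any bound on the number of parts, because a segment (1,1) consumes two parts but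
    one unit of fuel. *)
Lemma foldr_ksplit_rec n a b : (a + b <= n)%N ->
  foldr (opBB q) 1 (ksplit_rec 2 n (nseq a 2%N ++ nseq b 1%N)) = twos q a b.
Proof.
elim: n a b => [|n IH] [|a] b //=.
- by case: b.
- case: b => [|b] // bn; rewrite [ksplit_rec _ _ _]/= -[1%N :: _]/(nseq b.+1 1%N).
  rewrite segment_length_1; case: b bn => [|b] bn /=.
    rewrite opBB1; case: n {IH bn} => //.
  rewrite take0 drop0 opBB11 (IH 0%N b) //; lia.
move=> abn; rewrite segment_length_2 /= take0 drop0 opBB1 IH //; lia.
Qed.

Lemma Ck2 a b : Ck q 2 (nseq a 2%N ++ nseq b 1%N) = twos q a b.
Proof. by apply: foldr_ksplit_rec; rewrite size_cat !size_nseq. Qed.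

Lemma kbounded2P la : kbounded 2 la ->
  exists a b, la = nseq a 2%N ++ nseq b 1%N.
Proof.
rewrite /kbounded /is_partition => /andP[/andP[]].
elim: la => [|x la IH] /=; first by exists 0%N, 0%N.
move=> xla; rewrite inE negb_or => /andP[x0 la0] /andP[x2 la2].
have [a [b laE]] := IH (path_sorted xla) la0 la2.
case: x x0 x2 xla => [|[|[|x]]] // _ _ xla; last by exists a.+1, b; rewrite laE.
case: a laE => [|a] laE; first by exists 0%N, b.+1; rewrite laE.
by move: xla; rewrite laE.
Qed.

(* The coefficient of h_1^b in the basis of the h_la. *)
Definition ones_coef b f : F := hall f (m_part F (nseq b 1%N)).

Lemma ones_coefD b f g : ones_coef b (f + g) = ones_coef b f + ones_coef b g.
Proof. exact: hallDl. Qed.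

Lemma ones_coefZ b c f : ones_coef b (c *: f) = c * ones_coef b f.
Proof. exact: hallZl. Qed.

Lemma ones_coef0 b : ones_coef b 0 = 0.
Proof. by rewrite -(scale0r 0) ones_coefZ mul0r. Qed.

Lemma ones_coef_sum b (I : Type) (r : seq I) (P : pred I) (G : I -> Lam) :
  ones_coef b (\sum_(i <- r | P i) G i) = \sum_(i <- r | P i) ones_coef b (G i).
Proof.
by elim/big_rec2: _ => [|i x f _ <-]; rewrite ?ones_coef0 ?ones_coefD.
Qed.

Lemma nonzeros_ones b : nonzeros (nseq b 1%N) = nseq b 1%N.
Proof. by apply: nonzeros_id; rewrite mem_nseq andbF. Qed.

Lemma coef_m_ones b s :
  m_part F (nseq b 1%N) s = (perm_eq (nonzeros s) (nseq b 1%N))%:R.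
Proof. by rewrite -[in RHS]nonzeros_ones. Qed.

Lemma ones_coef1 b : ones_coef b 1 = (b == 0%N)%:R.
Proof.
by rewrite /ones_coef -h_part_nil hall_h_part coef_m_ones; case: b.
Qed.

Lemma ones_coef_h b r f : (1 < r)%N -> ones_coef b (h (Posz r) * f) = 0.
Proof.
move=> r1; rewrite /ones_coef hall_h (_ : cperp _ _ = 0).
  by rewrite -(scale0r 0) hallZr mul0r.
apply: LamE => s; rewrite cperpE coef_m_ones; case: r r1 => [|[|r]] // _.
case: (boolP (perm_eq _ _)) => // /perm_mem /(_ r.+2).
by rewrite mem_nseq inE eqxx andbF.
Qed.

Lemma ones_coef_h1 b f :
  ones_coef b (h 1 * f) = if b is b'.+1 then ones_coef b' f else 0.
Proof.
rewrite /ones_coef (hall_h 1); case: b => [|b].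
  rewrite (_ : cperp _ _ = 0); first by rewrite -(scale0r 0) hallZr mul0r.
  apply: LamE => s; rewrite cperpE coef_m_ones.
  by case: (boolP (perm_eq _ _)) => // /perm_size.
by congr hall; apply: LamE => s; rewrite cperpE !coef_m_ones /= perm_cons.
Qed.

(** Every term of B_2 f carries a factor h_(2+k), which no power of h_1 contains. *)
Lemma ones_coef_opB2 b f : ones_coef b (B 2 f) = 0.
Proof.
have [d sf] := smallP f; rewrite (opBE _ _ sf (leqnn _)) ones_coef_sum.
by rewrite big1 // => k _; rewrite ones_coef_h //; lia.
Qed.

Lemma ones_coef_opB1 b f :
  ones_coef b (B 1 f) = if b is b'.+1 then ones_coef b' f else 0.
Proof.
have [d sf] := smallP f; rewrite (opBE _ _ sf (leqnSn _)) big_ord_recl.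
rewrite ones_coefD ones_coef_sum [X in _ + X]big1 => [|k _]; last first.
  by rewrite lift0 ones_coef_h //; lia.
by rewrite addr0 addr0 ones_coef_h1; case: b => // b; rewrite opP0.
Qed.

(** B_2 B_0 contributes nothing here, so each B_(1,1) raises the power of h_1 by two. *)
Lemma ones_coef_ones b n : ones_coef b (ones q n) = (b == n)%:R.
Proof.
elim/ltn_ind: n b => -[|[|n]] IH b; first exact: ones_coef1.
  by rewrite ones_coef_opB1; case: b => // b; rewrite ones_coef1.
rewrite onesSS -scaleN1r ones_coefD ones_coefZ ones_coef_opB2 mulr0 addr0.
rewrite ones_coef_opB1; case: b => // b; rewrite ones_coef_opB1.
by case: b => // b; rewrite IH.
Qed.

(** Closed formulas for T_1 and T_2 on combinations of C_la with at most [N] parts. The first sum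
    starts at (1); the second also removes the empty partition. *)
Definition T1_formula N f := \sum_(b < N) ones_coef b.+1 f *: ones q b.+1.
Definition T2_formula N f := f - \sum_(b < N.+1) ones_coef b f *: ones q b.

Lemma T1_formula_sum N (I : Type) (r : seq I) (c : I -> F) (G : I -> Lam) :
  T1_formula N (\sum_(i <- r) c i *: G i) = \sum_(i <- r) c i *: T1_formula N (G i).
Proof.
rewrite /T1_formula; under [RHS]eq_bigr do rewrite scaler_sumr.
rewrite exchange_big; apply: eq_bigr => b _.
rewrite ones_coef_sum scaler_suml; apply: eq_bigr => i _.
by rewrite ones_coefZ scalerA.
Qed.

Lemma T2_formula_sum N (I : Type) (r : seq I) (c : I -> F) (G : I -> Lam) :
  T2_formula N (\sum_(i <- r) c i *: G i) = \sum_(i <- r) c i *: T2_formula N (G i).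
Proof.
rewrite /T2_formula; under [RHS]eq_bigr do rewrite scalerBr scaler_sumr.
rewrite sumrB; congr (_ - _); rewrite exchange_big; apply: eq_bigr => b _.
rewrite ones_coef_sum scaler_suml; apply: eq_bigr => i _.
by rewrite ones_coefZ scalerA.
Qed.

Lemma T1_formula_Ck N la : kbounded 2 la -> (size la <= N)%N ->
  T1_formula N (Ck q 2 la) = if head 0%N la == 1%N then Ck q 2 la else 0.
Proof.
move=> /kbounded2P[[|a] [b ->]]; rewrite Ck2 size_cat !size_nseq => bN.
  case: b bN => [|b] bN.
    by rewrite /T1_formula big1 // => i _; rewrite ones_coef_ones scale0r.
  rewrite /T1_formula (bigD1 (Ordinal bN)) //= ones_coef_ones eqxx scale1r.
  rewrite big1 ?addr0 // => i; rewrite -val_eqE /= => /negPf ib.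
  by rewrite ones_coef_ones eqSS ib scale0r.
by rewrite /T1_formula big1 // => i _; rewrite ones_coef_opB2 scale0r.
Qed.

Lemma T2_formula_Ck N la : kbounded 2 la -> (size la <= N)%N ->
  T2_formula N (Ck q 2 la) = if head 0%N la == 2%N then Ck q 2 la else 0.
Proof.
move=> /kbounded2P[[|a] [b ->]]; rewrite Ck2 size_cat !size_nseq => bN.
  have bN' : (b < N.+1)%N by [].
  rewrite /T2_formula (bigD1 (Ordinal bN')) //= ones_coef_ones eqxx scale1r.
  rewrite big1 ?addr0 ?subrr => [|i]; first by case: b {bN bN'}.
  rewrite -val_eqE /= => /negPf ib.
  by rewrite ones_coef_ones ib scale0r.
by rewrite /T2_formula big1 ?subr0 // => i _; rewrite ones_coef_opB2 scale0r.
Qed.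

(** A linear formula correct on every C_la recovers [g] from [f] alone, so any two expansions of [f]
    give the same result once [N] exceeds the lengths of all partitions in both. *)
Lemma is_T_formula (T : nat -> Lam -> Lam) i :
    (forall N (r : seq (seq nat)) (c : seq nat -> F) (G : seq nat -> Lam),
       T N (\sum_(la <- r) c la *: G la) = \sum_(la <- r) c la *: T N (G la)) ->
    (forall N la, kbounded 2 la -> (size la <= N)%N ->
       T N (Ck q 2 la) = if head 0%N la == i then Ck q 2 la else 0) ->
  forall f g, is_T q 2 i f g -> opT q 2 i f = g.
Proof.
move=> Tsum TCk f.
have ev g : is_T q 2 i f g -> exists N0, forall N, (N0 <= N)%N -> g = T N f.
  move=> [L [c [bL -> ->]]]; exists (\max_(la <- L) size la)%N => N LN.
  rewrite Tsum big_mkcond; apply: eq_big_seq => la laL.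
  rewrite TCk; [|exact: (allP bL)|].
    by case: ifP => // _; rewrite scaler0.
  by apply: leq_trans LN; apply: leq_bigmax_seq.
move=> g Tg; rewrite /opT; case: xgetP => [g' _ Tg'|/(_ g) //].
have [N0 E0] := ev _ Tg; have [N1 E1] := ev _ Tg'.
by rewrite (E0 (maxn N0 N1)) ?leq_maxl // (E1 (maxn N0 N1)) ?leq_maxr.
Qed.

Lemma opT1P f g : is_T q 2 1 f g -> opT q 2 1 f = g.
Proof.
apply: (is_T_formula (T := T1_formula)) => N; first exact: T1_formula_sum.
exact: T1_formula_Ck.
Qed.

Lemma opT2P f g : is_T q 2 2 f g -> opT q 2 2 f = g.
Proof.
apply: (is_T_formula (T := T2_formula)) => N; first exact: T2_formula_sum.
exact: T2_formula_Ck.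
Qed.

(** * Values of T_1 and T_2, and the recursion for 2-Schur functions *)

Lemma kbounded2 a b : kbounded 2 (nseq a 2%N ++ nseq b 1%N).
Proof.
have sorted1 : path.sorted geq (nseq b 1%N).
  by case: b => // b; elim: b => //= b ->.
rewrite /kbounded /is_partition all_cat !all_nseq !orbT mem_cat !mem_nseq !andbF !andbT.
by elim: a => [//|[|a] IH] /=; rewrite ?IH //; case: b sorted1 {IH}.
Qed.

Lemma opT2_twos a b : opT q 2 2 (twos q a.+1 b) = twos q a.+1 b.
Proof.
apply: opT2P; exists [:: nseq a.+1 2%N ++ nseq b 1%N], (fun=> 1); split.
- by rewrite all_seq1 kbounded2.
- by rewrite big_seq1 Ck2 scale1r.
- by rewrite big_mkcond big_seq1 Ck2 scale1r.
Qed.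

Lemma opT1_ones n d f : even_span q d f ->
  opT q 2 1 (ones q n.+1 + B 2 f) = ones q n.+1.
Proof.
move=> [c ->]; apply: opT1P.
pose L := [seq nseq a.+1 2%N ++ nseq (d - a).*2 1%N | a <- iota 0 d.+1].
have bL : all (kbounded 2) L.
  by apply/allP => la /mapP[a _ ->]; apply: kbounded2.
exists (nseq n.+1 1%N :: L).
(* The index a of a correction term is recovered from (2^(a+1), 1^(2(d-a))) as the number of 2s
   minus one. *)
exists (fun la => if head 0%N la == 1%N then 1 else c (count_mem 2%N la).-1); split.
- by apply/andP; split; first exact: (kbounded2 0 n.+1).
- rewrite big_cons scale1r (Ck2 0 n.+1); congr (_ + _).
  rewrite big_map opB_sum.
  rewrite -(big_mkord xpredT (fun a => B 2 (c a *: twos q a (d - a).*2))).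
  rewrite /index_iota subn0; apply: eq_bigr => a _.
  by rewrite opBZ Ck2 /= count_cat !count_nseq /= mul1n mul0n addn0.
by rewrite big_cons scale1r (Ck2 0 n.+1) big_map big1 ?addr0.
Qed.

Hypothesis two_neq0 : 2%:R != 0 :> F.

Lemma schur1 m : schur F [:: m] = h (Posz m).
Proof.
by rewrite /schur det_mx11 mxE /= subr0 addr0.
Qed.

(** The column of 1s is built first, T_1 deleting the correction from [opB1_ones]; each further 2
    only applies B_2, whose result T_2 fixes. *)
Lemma kschur2 a b : kschur q 2 (nseq a 2%N ++ nseq b 1%N) = twos q a b.
Proof.
elim: a => [|a IHa].
  elim: b => [|b IHb] //; rewrite [LHS]/=; case: b IHb => [_|b IHb].
    by rewrite schur1 -(opB_one q 1).
  have [f [d [fW E]]] := opB1_ones q two_neq0 b.+1.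
  by rewrite [kschur _ _ _]IHb E (opT1_ones _ fW).
rewrite [LHS]/=; case E: (nseq a 2%N ++ nseq b 1%N) => [|x la].
  case: a b E {IHa} => [|//] [|//] _.
  by rewrite schur1 -(opB_one q 2).
by rewrite -E IHa -opT2_twos.
Qed.

End TwoSchur.

Lemma two_neq0_Qq : 2%:R != 0 :> Qq.
Proof.
rewrite -(rmorph_nat (@tofrac {poly rat})) tofrac_eq0 -polyC_natr polyC_eq0.
by rewrite Num.Theory.pnatr_eq0.
Qed.

Theorem theorem5p4 (n l : nat) (hn : (1 <= n)%N) (hl : (l.*2 <= n)%N) :
  kschur qq 2 (nseq l 2%N ++ nseq (n - l.*2) 1%N)
  = foldr (opBB qq) 1 (ksplit 2 (nseq l 2%N ++ nseq (n - l.*2) 1%N)).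
Proof. by rewrite kschur2 ?two_neq0_Qq // -[RHS]/(Ck qq 2 _) Ck2. Qed.
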